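(* Let $R=\mathbb Z_2[x_1^{\pm1},x_2^{\pm1},x_3^{\pm1}]$, $\Lambda=2\mathbb Z^3$, and $R_\Lambda=\mathbb Z_2[\Lambda]=\mathbb Z_2[x_1^{\pm2},x_2^{\pm2},x_3^{\pm2}]$. For every $\mathbf a\in\mathbb Z_2^3$, uniform $2\times2\times2$ blocking gives $$\mathcal C_{\mathbf a}\sim_{R_\Lambda,\mathrm{Cl}}\mathcal C_{\mathbf 0}.$$ Thus all eight models $\mathcal C_{\mathbf a}$ share the intrinsic topological order of the decoupled stack $\mathcal C_{\mathbf0}=\mathrm{TC}^{(3)}_1(\mathbb Z_2)\oplus\mathrm{TC}^{(3)}_2(\mathbb Z_2)$.
   Context: Let $f_i=x_i-1$ for $i=1,2,3$, and $$\partial_1=\begin{pmatrix} f_1 & f_2 & f_3 \end{pmatrix},\quad \partial_2=\begin{pmatrix} 0 & f_3 & -f_2 \\ -f_3 & 0 & f_1 \\ f_2 & -f_1 & 0 \end{pmatrix},\quad \partial_3=\begin{pmatrix} f_1 \\ f_2 \\ f_3 \end{pmatrix}$$ (the Koszul differentials with $K_0=R$, $K_1=K_2=R^3$, $K_3=R$). With $\overline{x_i}=x_i^{-1}$ and $\varphi^\dagger=\overline\varphi^{\mathsf T}$, the topological CSS code $\mathcal C_{\mathbf a}$ ($\mathbf a=(a_1,a_2,a_3)^{\mathsf T}$) has $$\varphi_{X,\mathbf a}=\begin{pmatrix} \partial_1^\dagger & 0 \\ -\overline{\mathbf a} & \partial_2^\dagger \end{pmatrix},\qquad \varphi_{Z,\mathbf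 a}=\begin{pmatrix} \partial_2 & \mathbf a \\ 0 & \partial_3 \end{pmatrix}.$$ $\mathrm{TC}^{(3)}_j(\mathbb Z_2)$ ($j=1,2$) is the code with $\varphi_X=\partial_j^\dagger$, $\varphi_Z=\partial_{j+1}$. Blocking: $R$ is free over $R_\Lambda$ with basis $x_1^{\epsilon_1}x_2^{\epsilon_2}x_3^{\epsilon_3}$, $\epsilon_i\in\{0,1\}$, and $R$-matrices are viewed as $R_\Lambda$-matrices in these bases. For a commutative ring $A$, $\operatorname{E}_q(A)\subseteq\operatorname{GL}_q(A)$ is generated by $I+rE_{i,k}$, $r\in A$, $i\neq k$; $q\times a$ matrices satisfy $\varphi\sim_{A,\mathrm{Cl}}\varphi'$ if $W\varphi\Phi=\varphi'$ for some $W\in\operatorname{E}_q(A)$, $\Phi\in\operatorname{GL}_a(A)$. For topological CSS codes, $\mathcal C\sim_{A,\mathrm{Cl}}\mathcal C'$ means $\varphi_X\sim_{A,\mathrm{Cl}}\varphi'_X$ (the $Z$-stabilizer module, $\operatorname{im}\varphi_Z=\ker\varphi_X^\dagger$, is then transported by $(W^\dagger)^{-1}$); physically, a finite-depth $\Lambda$-translation-invariant CNOT circuit maps one stabilizer group to the other. Two models share the same intrinsic topological order if they are related by finite-depth local unitary circuits, with no translation symmetry required. *)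

(* Defs.v *)
From HB Require Import structures.
From mathcomp Require Import all_boot all_order all_algebra.
From mathcomp Require Import finmap monalg.

Set Implicit Arguments.
Unset Strict Implicit.
Unset Printing Implicit Defensive.

Import Order.TTheory GRing.Theory Num.Theory.
Local Open Scope fset_scope.
Local Open Scope ring_scope.

(* [{malg K[G]}] carries a product only when [G] is a monoid in which
   [x * y = 1] forces [x = y = 1], which excludes groups; the convolution
   product of a group algebra is therefore supplied here, on an alias. *)
Definition grpalg (K : comNzRingType) (G : zmodType) : Type := {malg K[G]}.

Section GroupAlgebra.
Variables (K : comNzRingType) (G : zmodType).
Implicit Types g : {malg K[G]}.

Definition gamul g1 g2 : {malg K[G]} :=
  \sum_(k1 <- msupp g1) \sum_(k2 <- msupp g2)
    << g1@_k1 * g2@_k2 *g (k1 + k2)%R >>.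

Definition gaone : {malg K[G]} := << 1 *g 0%R >>.

Lemma gamulw (d1 d2 : {fset G}) g1 g2 :
  msupp g1 `<=` d1 -> msupp g2 `<=` d2 ->
  gamul g1 g2 = \sum_(k1 <- d1) \sum_(k2 <- d2)
    << g1@_k1 * g2@_k2 *g (k1 + k2)%R >>.
Proof.
move=> le1 le2; rewrite /gamul (big_fset_incl _ le1) /=.
  apply/eq_bigr => k1 _; apply/big_fset_incl => // k _ /mcoeff_outdom ->.
  by rewrite mulr0 monalgU0.
move=> k _ /mcoeff_outdom g1k.
by rewrite big1 // => k' _; rewrite g1k mul0r monalgU0.
Qed.

Lemma gamulC : commutative gamul.
Proof.
move=> g1 g2; rewrite /gamul exchange_big /=.
by apply/eq_bigr => k2 _; apply/eq_bigr => k1 _; rewrite mulrC addrC.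
Qed.

Lemma gamulUU c1 c2 (k1 k2 : G) :
  gamul << c1 *g k1 >> << c2 *g k2 >> = << c1 * c2 *g (k1 + k2)%R >>.
Proof. by rewrite (gamulw msuppU_le msuppU_le) !big_seq_fset1 !mcoeffUU. Qed.

Lemma gamul0g g : gamul 0 g = 0.
Proof. by rewrite /gamul msupp0 big_seq_fset0. Qed.

Lemma gamulDl : left_distributive gamul +%R.
Proof.
move=> g1 g2 g.
rewrite [in RHS](gamulw (fsubsetUl _ (msupp g2)) (fsubset_refl _)).
rewrite [in RHS](gamulw (fsubsetUr (msupp g1) _) (fsubset_refl _)).
rewrite (gamulw (msuppD_le _ _) (fsubset_refl _)).
rewrite -big_split /=; apply/eq_bigr => k1 _.
rewrite -big_split /=; apply/eq_bigr => k2 _.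
by rewrite mcoeffD mulrDl monalgUD.
Qed.

Lemma gamul_suml (I : Type) (r : seq I) (F : I -> {malg K[G]}) g :
  gamul (\sum_(i <- r) F i) g = \sum_(i <- r) gamul (F i) g.
Proof.
exact: (big_morph (gamul^~ g) (fun x y => gamulDl x y g) (gamul0g g)).
Qed.

Lemma gamul_sumr (I : Type) (r : seq I) (F : I -> {malg K[G]}) g :
  gamul g (\sum_(i <- r) F i) = \sum_(i <- r) gamul g (F i).
Proof.
by rewrite gamulC gamul_suml; apply/eq_bigr => i _; rewrite gamulC.
Qed.

Lemma gamul1g : left_id gaone gamul.
Proof.
move=> g; rewrite [g in LHS]monalgE gamul_sumr [RHS]monalgE.
by apply/eq_bigr => k _; rewrite gamulUU mul1r add0r.
Qed.

Lemma gamulA : associative gamul.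
Proof.
move=> g1 g2 g3; rewrite [g1]monalgE !gamul_suml; apply/eq_bigr => k1 _.
rewrite [g2]monalgE !(gamul_suml, gamul_sumr); apply/eq_bigr => k2 _.
rewrite [g3]monalgE !(gamul_suml, gamul_sumr); apply/eq_bigr => k3 _.
by rewrite !gamulUU mulrA addrA.
Qed.

Lemma gaone_neq0 : gaone != 0.
Proof. by rewrite monalgU_eq0 oner_eq0. Qed.

HB.instance Definition _ := GRing.Zmodule.on (grpalg K G).
HB.instance Definition _ := GRing.Zmodule_isComNzRing.Build (grpalg K G)
  gamulA gamulC gamul1g gamulDl gaone_neq0.

Definition gacoef (m : G) (r : grpalg K G) : K := @mcoeff G K m r.
Definition gasupp (r : grpalg K G) : {fset G} := @msupp G K r.
Definition gamon (c : K) (m : G) : grpalg K G := @mkmalgU G K m c.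

End GroupAlgebra.

Notation lattice := ('rV[int]_3).

(* Z_2[x_1^{+-1}, x_2^{+-1}, x_3^{+-1}]; the monomial x^m is [xmon m]. *)
Notation Laurent := (grpalg 'F_2 lattice).

Definition xmon (m : lattice) : Laurent := gamon 1 m.
Definition xvar (i : 'I_3) : Laurent := xmon (delta_mx 0 i).
Definition lconst (c : 'F_2) : Laurent := gamon c 0.

Definition bar (r : Laurent) : Laurent :=
  \sum_(m <- gasupp r) gamon (gacoef m r) (- m).

Definition dag m n (phi : 'M[Laurent]_(m, n)) : 'M[Laurent]_(n, m) :=
  (map_mx bar phi)^T.

Definition in_Lambda (m : lattice) : bool := [forall i, (2 %| m ord0 i)%Z].

Definition over_Lambda_pred (r : Laurent) : bool :=
  [forall m : gasupp r, in_Lambda (val m)].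
Arguments over_Lambda_pred : simpl never.
Definition over_Lambda := [qualify a r | over_Lambda_pred r].

Lemma in_LambdaD m n : in_Lambda m -> in_Lambda n -> in_Lambda (m + n).
Proof.
move=> /forallP hm /forallP hn; apply/forallP => i.
by rewrite mxE rpredD ?hm ?hn.
Qed.

Lemma over_LambdaP (r : Laurent) :
  reflect (forall m, gacoef m r != 0 -> in_Lambda m) (r \is a over_Lambda).
Proof.
apply: (iffP forallP) => [h m | h [m mr] /=].
  by rewrite mcoeff_neq0 => mr; exact: (h [` mr]).
by apply: h; rewrite mcoeff_neq0.
Qed.

Lemma over_Lambda_subring : subring_closed over_Lambda.
Proof.
split=> [|r s|r s].
- apply/over_LambdaP => m; rewrite /gacoef mcoeffU.
  have [<- _|_] := eqVneq 0 m; last by rewrite mulr0n eqxx.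
  by apply/forallP => i; rewrite mxE.
- move=> /over_LambdaP hr /over_LambdaP hs; apply/over_LambdaP => m.
  apply: contraR => nm.
  have -> : gacoef m (r - s) = gacoef m r - gacoef m s by exact: mcoeffB.
  have /eqP -> : gacoef m r == 0 by apply: contraR nm => /hr.
  have /eqP -> : gacoef m s == 0 by apply: contraR nm => /hs.
  by rewrite subr0.
- move=> /over_LambdaP hr /over_LambdaP hs; apply/over_LambdaP => m.
  apply: contraR => nm; rewrite /gacoef raddf_sum big_seq big1 //= => k1 k1r.
  rewrite raddf_sum big_seq big1 //= => k2 k2s; rewrite mcoeffU.
  have [e|_] := eqVneq (k1 + k2) m; last by rewrite mulr0n.
  exfalso.
  case/negP: nm; rewrite -e; apply: in_LambdaD; [apply: hr | apply: hs];
    by rewrite /gacoef mcoeff_neq0.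
Qed.

HB.instance Definition _ :=
  GRing.isSubringClosed.Build Laurent over_Lambda_pred over_Lambda_subring.

(* Z_2[2 Z^3], as the subring of [Laurent] of elements supported on 2 Z^3. *)
Record RLambda := MkRLambda { RLval :> Laurent; _ : RLval \is a over_Lambda }.
HB.instance Definition _ := [isSub for RLval].
HB.instance Definition _ := [Choice of RLambda by <:].
HB.instance Definition _ := [SubChoice_isSubComNzRing of RLambda by <:].

(* Binary digits of [e] : the eight vectors of {0,1}^3. *)
Definition corner (e : 'I_8) : lattice := \row_(i < 3) ((e %/ 2 ^ i) %% 2)%N%:Z.

Definition coordL_val (e : 'I_8) (r : Laurent) : Laurent :=
  \sum_(m <- gasupp r | in_Lambda (m - corner e))
     gamon (gacoef m r) (m - corner e).

Lemma coordL_subproof e r : coordL_val e r \is a over_Lambda.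
Proof.
apply: rpred_sum => m hm; apply/over_LambdaP => k.
by rewrite /gacoef mcoeffU; have [<-|] := eqVneq (m - corner e) k.
Qed.

(* The coordinate of [r] on [xmon (corner e)] in the basis
   [xmon (corner 0), ..., xmon (corner 7)] of [Laurent] over [RLambda]. *)
Definition coordL (e : 'I_8) (r : Laurent) : RLambda :=
  MkRLambda (coordL_subproof e r).

(* Matrix over [RLambda] of the multiplication by [r]. *)
Definition block_scalar (r : Laurent) : 'M[RLambda]_8 :=
  \matrix_(e', e) coordL e' (r * xmon (corner e)).

Definition block q a (phi : 'M[Laurent]_(q, a)) :
    'M[RLambda]_(\sum_(i < q) 8, \sum_(k < a) 8) :=
  \mxblock_(i < q, k < a) block_scalar (phi i k).

(* The inverse of 1 + r E_ik is 1 - r E_ik, so closing under products gives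
   the subgroup generated. *)
Inductive elementary (A : comNzRingType) (q : nat) : 'M[A]_q -> Prop :=
| elementary1 : elementary 1%:M
| elementary_gen (r : A) (i k : 'I_q) :
    i != k -> elementary (1%:M + r *: delta_mx i k)
| elementaryM (W W' : 'M[A]_q) :
    elementary W -> elementary W' -> elementary (W *m W').

(* [unitmx] would require a decidable group of units in [A]. *)
Definition inGL (A : comNzRingType) (n : nat) (Phi : 'M[A]_n) : Prop :=
  exists Psi : 'M[A]_n, Phi *m Psi = 1%:M /\ Psi *m Phi = 1%:M.

Definition cl_equiv (A : comNzRingType) (q a : nat) (phi phi' : 'M[A]_(q, a)) :=
  exists (W : 'M[A]_q) (Phi : 'M[A]_a),
    [/\ elementary W, inGL Phi & W *m phi *m Phi = phi'].

(* [q] qubits per site; the columns are the generators of the X- and Z-type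
   stabilizers, up to translation. *)
Record css (q a b : nat) := CSS {
  phiX : 'M[Laurent]_(q, a);
  phiZ : 'M[Laurent]_(q, b)
}.

Definition topological q a b (C : css q a b) : Prop :=
  forall v : 'cV[Laurent]_q,
    dag (phiX C) *m v = 0 <-> exists w : 'cV[Laurent]_b, v = phiZ C *m w.

Definition css_sum q a b q' a' b' (C : css q a b) (C' : css q' a' b') :
    css (q + q') (a + a') (b + b') :=
  CSS (block_mx (phiX C) 0 0 (phiX C')) (block_mx (phiZ C) 0 0 (phiZ C')).

Definition blocked_cl_equiv q a b b' (C : css q a b) (C' : css q a b') : Prop :=
  [/\ topological C, topological C' & cl_equiv (block (phiX C)) (block (phiX C'))].

Definition f1 : Laurent := xvar 0 - 1.
Definition f2 : Laurent := xvar 1 - 1.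
Definition f3 : Laurent := xvar 2 - 1.

Definition seq_mx m n (s : seq (seq Laurent)) : 'M[Laurent]_(m, n) :=
  \matrix_(i, j) nth 0 (nth [::] s i) j.

Definition d1 : 'M[Laurent]_(1, 3) := seq_mx _ _ [:: [:: f1; f2; f3]].
Definition d2 : 'M[Laurent]_(3, 3) :=
  seq_mx _ _ [:: [::    0;  f3; - f2];
                 [:: - f3;   0;   f1];
                 [::   f2; - f1;   0]].
Definition d3 : 'M[Laurent]_(3, 1) :=
  seq_mx _ _ [:: [:: f1]; [:: f2]; [:: f3]].

Definition TC1 : css 3 1 3 := CSS (dag d1) d2.
Definition TC2 : css 3 3 1 := CSS (dag d2) d3.

Definition Ca (a : 'cV['F_2]_3) : css (3 + 3) (1 + 3) (3 + 1) :=
  let aR := map_mx lconst a in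
  CSS (block_mx (dag d1) 0 (- map_mx bar aR) (dag d2))
      (block_mx d2 aR 0 d3).

Section Circuits.
(* The scalars; the complex numbers are an instance. *)
Variable K : numClosedFieldType.
Variable q : nat.

Definition qubit : Type := (lattice * 'I_q)%type.
HB.instance Definition _ := Choice.on qubit.

(* Local operators act faithfully on arbitrary functions from the
   computational basis configurations of the infinite lattice to [K]. *)
Definition config := qubit -> 'F_2.
Definition wave := config -> K.
Definition operator := wave -> wave.

Definition restr (S : {fset qubit}) (s : config) : {ffun S -> 'F_2} :=
  [ffun j => s (val j)].
Definition patch (S : {fset qubit}) (s : config) (t : {ffun S -> 'F_2}) : config :=
  fun j => if insub j is Some k then t k else s j.

(* A matrix indexed by the configurations of [S], tensored with the identity
   on all other qubits. *)
Definition on_support (S : {fset qubit}) (M : 'M[K]_#|{ffun S -> 'F_2}|) :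
    operator :=
  fun psi s =>
    \sum_(t : {ffun S -> 'F_2})
       M (enum_rank (restr S s)) (enum_rank t) * psi (patch s t).

Definition supported_in (S : {fset qubit}) (O : operator) : Prop :=
  exists M, O = @on_support S M.

Record gate := Gate {
  gsupp : {fset qubit};
  gmx : 'M[K]_#|{ffun gsupp -> 'F_2}|;
  gate_unitary : gmx \is unitarymx
}.

Definition gate_conj (U : gate) (O : operator) : operator :=
  on_support (gmx U) \o O \o on_support (map_mx Num.conj (gmx U))^T.

Record layer := Layer {
  lidx : eqType;
  lgate :> lidx -> gate;
  layer_disjoint : forall i j, i != j ->
    [disjoint gsupp (lgate i) & gsupp (lgate j)]%fset;
  layer_range : exists r : int, forall i (x y : qubit),
    x \in gsupp (lgate i) -> y \in gsupp (lgate i) ->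
    forall k, `|x.1 0 k - y.1 0 k| <= r
}.

(* The infinite product of the gates of [L] conjugates the local operator [O]
   to [O'] : only the finitely many gates meeting a support of [O] matter. *)
Definition layer_maps (L : layer) (O O' : operator) : Prop :=
  exists (S : {fset qubit}) (l : seq (lidx L)),
    [/\ supported_in S O,
        uniq l,
        forall i, ~~ [disjoint gsupp (L i) & S]%fset -> i \in l
      & O' = foldr (fun i => gate_conj (L i)) O l].

Fixpoint circuit_maps (c : seq layer) (O O' : operator) : Prop :=
  if c is L :: c' then exists2 P, layer_maps L O P & circuit_maps c' P O'
  else O' = O.

Definition pauliX (v : 'cV[Laurent]_q) : operator :=
  fun psi s => psi (fun j => s j + gacoef j.1 (v j.2 0)).

Definition pauliZ (v : 'cV[Laurent]_q) : operator :=
  fun psi s =>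
    (-1) ^+ (\sum_(i < q) \sum_(m <- gasupp (v i 0%R)) s (m, i))%N * psi s.

(* Generated by the X- and Z-type stabilizers, with sign +1; these are
   involutions, so closing under products gives the group generated. *)
Inductive stabilizer a b (C : css q a b) : operator -> Prop :=
| stab1 : stabilizer C id
| stabX (w : 'cV[Laurent]_a) : stabilizer C (pauliX (phiX C *m w))
| stabZ (w : 'cV[Laurent]_b) : stabilizer C (pauliZ (phiZ C *m w))
| stabM O P : stabilizer C O -> stabilizer C P -> stabilizer C (O \o P).

Definition same_order a b a' b' (C : css q a b) (C' : css q a' b') : Prop :=
  exists c : seq layer,
    (forall O, stabilizer C O -> exists2 O', stabilizer C' O' & circuit_maps c O O')
    /\ (forall O', stabilizer C' O' -> exists2 O, stabilizer C O & circuit_maps c O O').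

End Circuits.

(* Main.v *)
Require Import Defs.
From mathcomp Require Import all_boot all_order all_algebra.
From mathcomp Require Import finmap monalg.
From Stdlib Require Import FunctionalExtensionality.
From mathcomp Require Import ring zify.

(* With [D_i = d/dx_i], which modulo 2 is linear over the Laurent polynomials in
   the [x_j^2], one has [D_i (x_i - 1) + (x_i - 1) D_i = 1], while [D_i] commutes
   with [x_j - 1] for [j <> i]. Followed by contraction with a second basis
   vector, the [D_i] give a null homotopy, linear over the blocked ring, of the
   chain map [a : K_3 -> K_1], [a^T : K_2 -> K_0] of the Koszul complex that
   twists [C_0] into [C_a]. The homotopy [h] gives the unipotent matrix
   [W = (1, 0; h, 1)], which is elementary, and a unipotent [Phi] with
   [W phi_X,a Phi = phi_X,0]. The entries of [h] move each even site to an odd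
   neighbour, so the CNOT circuit of [W] acts separately on the 2x2x2 cells: it is
   a single layer of disjoint gates. The codes are topological because
   [x_1 - 1, x_2 - 1, x_3 - 1] is a regular sequence, as one sees by evaluating at
   [x_i = 1]. *)

Set Implicit Arguments.
Unset Strict Implicit.
Unset Printing Implicit Defensive.

Import Order.TTheory GRing.Theory Num.Theory.
Local Open Scope fset_scope.
Local Open Scope ring_scope.

(** * Group algebras *)

Section AdditiveExtension.
Variables (K : comNzRingType) (G V : zmodType).
Variable phi : G -> K -> V.
Hypothesis phi_additive : forall m, {morph phi m : c d / c + d}.

(** The coefficient is passed to [phi] because [V] is only an additive group; additivity in the
    coefficient then determines the extension. *)
Definition gaext (r : grpalg K G) : V :=
  \sum_(m <- gasupp r) phi m (gacoef m r).

Let phi0 m : phi m 0 = 0.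
Proof. by apply: (addrI (phi m 0)); rewrite -phi_additive !addr0. Qed.

Lemma gaextw (d : {fset G}) (r : grpalg K G) :
  gasupp r `<=` d -> gaext r = \sum_(m <- d) phi m (gacoef m r).
Proof.
move=> le_rd; rewrite /gaext (big_fset_incl _ le_rd) //= => m _ mr.
by rewrite /gacoef mcoeff_outdom ?phi0.
Qed.

Lemma gaextD : {morph gaext : r s / r + s}.
Proof.
move=> r s.
have rsD : gasupp (r + s) `<=` gasupp r `|` gasupp s by exact: msuppD_le.
rewrite (gaextw rsD) [gaext r](gaextw (fsubsetUl _ (gasupp s))).
rewrite [gaext s](gaextw (fsubsetUr (gasupp r) _)) -big_split /=.
by apply: eq_bigr => m _; rewrite -phi_additive; congr phi; exact: mcoeffD.
Qed.

Lemma gaext_mon c m : gaext (gamon c m) = phi m c.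
Proof.
rewrite (gaextw (d := [fset m])); last exact: msuppU_le.
by rewrite big_seq_fset1 /gacoef mcoeffUU.
Qed.

End AdditiveExtension.

Section Monomials.
Variables (K : comNzRingType) (G : zmodType).
Implicit Types r s : grpalg K G.

Lemma gacoef0 (m : G) : gacoef m (0 : grpalg K G) = 0.
Proof. exact: mcoeff0. Qed.

Lemma gacoefD (m : G) r s : gacoef m (r + s) = gacoef m r + gacoef m s.
Proof. exact: mcoeffD. Qed.

Lemma gacoef_mon (c : K) (m n : G) : gacoef n (gamon c m) = c *+ (m == n).
Proof. exact: mcoeffU. Qed.

Lemma gamon0 (m : G) : gamon 0 m = 0 :> grpalg K G.
Proof. exact: monalgU0. Qed.

Lemma gamonM (c d : K) (m n : G) : gamon c m * gamon d n = gamon (c * d) (m + n).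
Proof. exact: gamulUU. Qed.

Lemma gaE r : r = \sum_(m <- gasupp r) gamon (gacoef m r) m.
Proof. exact: monalgE. Qed.

Lemma gacoef_eqP r s : (forall m, gacoef m r = gacoef m s) -> r = s.
Proof. by move=> h; apply/malgP. Qed.

End Monomials.

Lemma F2_cases (c : 'F_2) : c = 0 \/ c = 1.
Proof.
by case: c => [[|[|//]] ?]; [left | right]; apply: val_inj.
Qed.

Lemma F2_addrr (c : 'F_2) : c + c = 0.
Proof. by have [->|->] := F2_cases c; apply: val_inj. Qed.

(* The universal property of the group algebra. Unification on [Laurent] itself
   unfolds finitely supported functions and is intractable, so the algebra is
   done in an arbitrary ring with this property. *)
Record laurent_model := LaurentModel {
  lm_ring :> comNzRingType;
  mono : lattice -> lm_ring;
  lext : forall V : zmodType, (lattice -> V) -> lm_ring -> V;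
  mono0 : mono 0 = 1;
  monoD : forall m n, mono (m + n) = mono m * mono n;
  lm_ind : forall P : lm_ring -> Prop,
    P 0 -> (forall m, P (mono m)) -> (forall r s, P r -> P s -> P (r + s)) ->
    forall r, P r;
  lm_addrr : forall r : lm_ring, r + r = 0;
  lextD : forall (V : zmodType) (phi : lattice -> V), (forall v : V, v + v = 0) ->
    {morph lext phi : r s / r + s};
  lext_mono : forall (V : zmodType) (phi : lattice -> V), (forall v : V, v + v = 0) ->
    forall m, lext phi (mono m) = phi m
}.

Section LaurentModelOfLaurent.

(** Coefficients are 0 or 1, so every element is a sum of monomials and scalars form no separate
    case. *)
Lemma Laurent_ind (P : Laurent -> Prop) :
  P 0 -> (forall m, P (xmon m)) -> (forall r s, P r -> P s -> P (r + s)) ->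
  forall r, P r.
Proof.
move=> P0 Pmon PD r; rewrite (gaE r); apply: big_ind => [||m _].
- exact: P0.
- exact: PD.
have [->|->] := F2_cases (gacoef m r); last exact: Pmon.
by rewrite gamon0.
Qed.

Lemma xmonD m n : xmon (m + n) = xmon m * xmon n.
Proof. by rewrite /xmon gamonM mulr1. Qed.

Lemma xmon0 : xmon 0 = 1.
Proof. by []. Qed.

Lemma Laurent_addrr (r : Laurent) : r + r = 0.
Proof. by apply: gacoef_eqP => m; rewrite gacoefD gacoef0 F2_addrr. Qed.

Variable V : zmodType.
Variable phi : lattice -> V.
Hypothesis V2 : forall v : V, v + v = 0.

Let phi_additive (m : lattice) : {morph (fun c : 'F_2 => phi m *+ c) : c d / c + d}.
Proof.
by move=> c d; case: (F2_cases c) => ->; case: (F2_cases d) => ->;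
  rewrite !(mulr0n, addr0, add0r, mulr1n) ?V2.
Qed.

(** The coefficient [c] acts through its representative 0 or 1; this is additive because [V] has
    exponent 2. *)
Definition Laurent_lift : Laurent -> V := gaext (fun m (c : 'F_2) => phi m *+ c).

Lemma Laurent_liftD : {morph Laurent_lift : r s / r + s}.
Proof. exact: gaextD. Qed.

Lemma Laurent_lift_xmon m : Laurent_lift (xmon m) = phi m.
Proof. by rewrite /Laurent_lift gaext_mon. Qed.

End LaurentModelOfLaurent.

Definition laurentM : laurent_model :=
  @LaurentModel Laurent xmon _ xmon0 xmonD Laurent_ind Laurent_addrr
    Laurent_liftD Laurent_lift_xmon.

Local Notation step i := (delta_mx 0 i : lattice).

(** * Monomial maps and the parity-dependent homotopy operators *)

Section Model.
Variable M : laurent_model.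
Implicit Types r s : M.

Lemma lm_oppr r : - r = r.
Proof. by apply/eqP; rewrite eq_sym -addr_eq0 lm_addrr. Qed.

Lemma lm_addrK2 r s : r + s + s = r.
Proof. by rewrite -addrA lm_addrr addr0. Qed.

Section Additive.
Variable V : zmodType.
Variable F : M -> V.
Hypothesis FD : {morph F : r s / r + s}.

Lemma morph_add0 : F 0 = 0.
Proof. by apply: (addrI (F 0)); rewrite -FD !addr0. Qed.

Lemma morph_sum (I : Type) (l : seq I) (P : pred I) (E : I -> M) :
  F (\sum_(i <- l | P i) E i) = \sum_(i <- l | P i) F (E i).
Proof. exact: (big_morph F FD morph_add0). Qed.

End Additive.

Lemma eq_mono (V : zmodType) (F H : M -> V) :
  {morph F : r s / r + s} -> {morph H : r s / r + s} ->
  (forall m, F (mono M m) = H (mono M m)) -> F =1 H.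
Proof.
move=> FD HD FH; elim/lm_ind => [|//|r s]; last by rewrite FD HD => -> ->.
by rewrite !morph_add0.
Qed.

Definition mlift (phi : lattice -> M) : M -> M := lext phi.

Lemma mliftD phi : {morph mlift phi : r s / r + s}.
Proof. exact: (lextD _ (@lm_addrr M)). Qed.

Lemma mlift0 phi : mlift phi 0 = 0. Proof. exact: morph_add0 (mliftD phi). Qed.

Lemma mlift_mono phi m : mlift phi (mono M m) = phi m.
Proof. by apply: lext_mono; exact: lm_addrr. Qed.

Section Pushforward.
Variable u : lattice -> lattice.

(** Negating exponents gives the conjugation [mbar]; erasing one exponent gives the evaluation at
    [x_i = 1]. *)
Definition push := mlift (fun m => mono M (u m)).

Lemma pushD : {morph push : r s / r + s}. Proof. exact: mliftD. Qed.

Lemma push0 : push 0 = 0. Proof. exact: mlift0. Qed.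

Lemma push_mono m : push (mono M m) = mono M (u m).
Proof. exact: mlift_mono. Qed.

Hypothesis uD : {morph u : m n / m + n}.

Lemma pushM : {morph push : r s / r * s}.
Proof.
move=> r s; elim/lm_ind: r => [|m|r r' IH IH'].
- by rewrite mul0r push0 mul0r.
- elim/lm_ind: s => [|n|s s' IH IH']; first by rewrite !(mulr0, push0).
    by rewrite -monoD !push_mono uD monoD.
  by rewrite mulrDr !pushD IH IH' mulrDr.
- by rewrite mulrDl !pushD IH IH' mulrDl.
Qed.

Lemma push1 : push 1 = 1.
Proof.
rewrite -(mono0 M) push_mono; congr mono.
by apply: (addrI (u 0)); rewrite -uD !addr0.
Qed.

End Pushforward.

Definition mbar := push -%R.

Let opprD_morph : {morph (-%R : lattice -> lattice) : m n / m + n}.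
Proof. exact: opprD. Qed.

Lemma mbarD : {morph mbar : r s / r + s}. Proof. exact: pushD. Qed.

Lemma mbar0 : mbar 0 = 0. Proof. exact: push0. Qed.

Lemma mbar1 : mbar 1 = 1. Proof. exact: push1 opprD_morph. Qed.

Lemma mbar_mono m : mbar (mono M m) = mono M (- m). Proof. exact: push_mono. Qed.

Definition even_at (i : 'I_3) (m : lattice) : bool := (2 %| m ord0 i)%Z.

Definition unit_step (b : bool) (i : 'I_3) : lattice :=
  if b then - step i else step i.

Lemma even_atD i m n : even_at i n -> even_at i (m + n) = even_at i m.
Proof. by rewrite /even_at mxE => en; rewrite rpredDr. Qed.

Lemma even_at_step b i j m :
  even_at i (unit_step b j + m) = (i == j) (+) even_at i m.
Proof.
rewrite /even_at /unit_step; case: b; rewrite !mxE eqxx /=; case: eqP => _;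
  rewrite ?(mulr0n, oppr0, add0r) //= !dvdzE /=; lia.
Qed.

(* [fac false i = x_i - 1] and [fac true i] is its conjugate. *)
Definition fac (b : bool) (i : 'I_3) : M := mono M (unit_step b i) - 1.

(* Modulo 2, [hop false i] is the partial derivative by [x_i], which commutes
   with the squares of the variables, and [hop true i] is its transpose. *)
Definition hop (b : bool) (i : 'I_3) :=
  mlift (fun m => if even_at i m == b then mono M (m - unit_step b i) else 0).

Lemma hopD b i : {morph hop b i : r s / r + s}. Proof. exact: mliftD. Qed.

Lemma hop0 b i : hop b i 0 = 0. Proof. exact: mlift0. Qed.

Lemma hop_mono b i m : hop b i (mono M m) =
  if even_at i m == b then mono M (m - unit_step b i) else 0.
Proof. exact: mlift_mono. Qed.

(** A step along [i] flips the parity at [i], so exactly one of the two monomials of [fac b i * x^m]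
    survives [hop b i]. A step along another axis keeps that parity, and the operators commute. *)
Lemma hop_fac b i j r :
  hop b i (fac b j * r) = fac b j * hop b i r + (r *+ (i == j)).
Proof.
elim/lm_ind: r => [|m|r s IHr IHs]; first by rewrite !(hop0, mulr0, mul0rn, addr0).
  rewrite /fac !lm_oppr !mulrDl !mul1r hopD -monoD !hop_mono even_at_step.
  have [<-|_] := eqVneq i j; last first.
    rewrite mulr0n addr0 addFb; case: ifP => _; last by rewrite mulr0.
    by rewrite -monoD addrA.
  rewrite mulr1n addTb.
  have -> : (~~ even_at i m == b) = ~~ (even_at i m == b) by case: even_at; case: b.
  case: eqP => _ /=.
    by rewrite add0r -monoD addrCA subrr addr0 addrAC lm_addrr add0r.
  by rewrite mulr0 !(addr0, add0r) addrC addKr.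
rewrite mulrDr !hopD IHr IHs mulrDr mulrnDl; ring.
Qed.

Lemma hop_Lambda b i n r : in_Lambda n ->
  hop b i (mono M n * r) = mono M n * hop b i r.
Proof.
move=> /forallP Ln; elim/lm_ind: r => [|m|r s IHr IHs].
- by rewrite !(mulr0, hop0).
- rewrite -monoD !hop_mono addrC even_atD; last exact: Ln.
  by case: ifP => _; rewrite ?mulr0 // -monoD addrA [n + m]addrC.
- by rewrite mulrDr !hopD IHr IHs mulrDr.
Qed.

Definition cst (c : 'F_2) : M := 1 *+ c.

Lemma cst_cases c : cst c = 0 \/ cst c = 1.
Proof. by case: (F2_cases c) => ->; [left | right]. Qed.

End Model.

(** * Koszul complexes *)

Section Koszul.
Variable M : laurent_model.
Implicit Types r s t : M.

Definition kill (i : 'I_3) (m : lattice) : lattice :=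
  \row_k (if k == i then 0 else m ord0 k).

Lemma killD i : {morph kill i : m n / m + n}.
Proof. by move=> m n; apply/rowP => k; rewrite !mxE; case: eqP; rewrite ?addr0. Qed.

Lemma kill_step i j : kill i (step j) = if i == j then 0 else step j.
Proof.
apply/rowP => k; rewrite !mxE; have [->|ki] := eqVneq k i.
  by case: eqP => [|/eqP ij]; rewrite !mxE // (negPf ij) andbF.
have [<-|ij] := eqVneq i j; last by rewrite mxE.
by rewrite mxE (negPf ki) andbF.
Qed.

Lemma killE i m : kill i m + step i *~ (m ord0 i) = m.
Proof.
apply/rowP => k; rewrite -scaler_int !mxE intz.
by have [->|ki] := eqVneq k i; rewrite ?mulr1 ?mulr0 ?add0r ?addr0.
Qed.

(* Evaluation at [x_i = 1]. *)
Definition eval1 (i : 'I_3) : M -> M := push (kill i).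

Lemma eval1_fac i j : eval1 i (fac M false j) = if i == j then 0 else fac M false j.
Proof.
rewrite /fac lm_oppr /eval1 pushD push1; last exact: killD.
rewrite push_mono /unit_step kill_step; case: eqP => // _.
by rewrite mono0 lm_addrr.
Qed.

(* [(x_i^n - 1) / (x_i - 1)] *)
Definition geo (i : 'I_3) (n : int) : M :=
  match n with
  | Posz k => \sum_(j < k) mono M (step i *~ j%:Z)
  | Negz k => \sum_(j < k.+1) mono M (step i *~ - j.+1%:Z)
  end.

(** For negative [n] the quotient is minus the sum of [x_i^-1, ..., x_i^n]; modulo 2 the sign
    disappears, and one recurrence holds across zero. *)
Lemma geoD1 i n : geo i (n + 1) = geo i n + mono M (step i *~ n).
Proof.
case: n => [k|k]; first by rewrite -PoszD addn1 /geo big_ord_recr.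
case: k => [|k].
  have -> : Negz 0 + 1 = Posz 0 by [].
  by rewrite {1}/geo big_ord0 /geo big_ord1 NegzE lm_addrr.
have -> : Negz k.+1 + 1 = Negz k by lia.
by rewrite /geo [in RHS]big_ord_recr /= -NegzE lm_addrK2.
Qed.

Lemma fac_geo i n : fac M false i * geo i n = mono M (step i *~ n) - 1.
Proof.
have xS k : mono M (step i *~ (k + 1)) = mono M (step i) * mono M (step i *~ k).
  by rewrite -monoD mulrzDr mulr1z addrC.
elim/int_rect: n => [|n IH|n IH]; rewrite -?[0]/(Posz 0).
- by rewrite /geo big_ord0 mulr0 mulr0z mono0 subrr.
- rewrite -addn1 PoszD geoD1 mulrDr IH xS /fac /=; ring.
- have e : - n%:Z = - n.+1%:Z + 1 by lia.
  move: IH; rewrite {1 2}e geoD1 mulrDr xS /fac /= => IH.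
  rewrite -[LHS](addrK ((mono M (step i) - 1) * mono M (step i *~ - n.+1%:Z))) IH.
  ring.
Qed.

(** The quotient in the division by [x_i - 1] with remainder [eval1 i]: on monomials, [x^m] minus
    its value at [x_i = 1] is that value times [x_i^(m_i) - 1]. *)
Definition quo1 (i : 'I_3) : M -> M :=
  mlift (fun m => mono M (kill i m) * geo i (m ord0 i)).

Lemma eval1_quo1 i r : r = eval1 i r + fac M false i * quo1 i r.
Proof.
elim/lm_ind: r => [|m|r s IHr IHs].
- by rewrite /eval1 push0 /quo1 mlift0 mulr0 addr0.
- rewrite /eval1 push_mono /quo1 mlift_mono mulrCA fac_geo.
  by rewrite mulrBr mulr1 addrC subrK -monoD killE.
- by rewrite {1}IHr {1}IHs /eval1 pushD /quo1 mliftD mulrDr addrACA.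
Qed.

(** By the recurrence for [geo], the quotients of [x_i x^m] and [x^m] differ by [x^m]. This left
    inverse shows that [x_i - 1] is not a zero divisor. *)
Lemma quo1_fac i r : quo1 i (fac M false i * r) = r.
Proof.
have qD : {morph quo1 i : r s / r + s} by exact: mliftD.
elim/lm_ind: r => [|m|r s IHr IHs].
- by rewrite mulr0 /quo1 mlift0.
- rewrite /fac lm_oppr mulrDl mul1r qD -monoD /quo1 !mlift_mono killD /= kill_step.
  rewrite eqxx add0r /unit_step !mxE !eqxx /=.
  rewrite [X in geo i X]addrC geoD1 mulrDr addrAC lm_addrr.
  by rewrite add0r -monoD killE.
- by rewrite mulrDr qD IHr IHs.
Qed.

Local Notation f := (fac M false).

Lemma fac_inj i r : f i * r = 0 -> r = 0.
Proof. by move=> fr; rewrite -(quo1_fac i r) fr /quo1 mlift0. Qed.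

Lemma eval1M i r s : eval1 i (r * s) = eval1 i r * eval1 i s.
Proof. by rewrite /eval1 pushM //; exact: killD. Qed.

(** Setting [x_j = 1] leaves [f i] times the value of [r]; that value is therefore zero, and [r] is
    a multiple of [f j]. *)
Lemma fac_regular2 i j r s :
  i != j -> f i * r + f j * s = 0 -> exists t, r = f j * t.
Proof.
move=> ij /(congr1 (eval1 j)); rewrite /eval1 pushD push0 -/(eval1 j) !eval1M.
rewrite !eval1_fac eqxx eq_sym (negPf ij) mul0r addr0 => /fac_inj r0.
by exists (quo1 j r); rewrite {1}(eval1_quo1 j r) r0 add0r.
Qed.

(** Setting [x_k = 1] reduces to the case of two terms; the division by [f k] then lifts the answer
    back to [r]. *)
Lemma fac_regular3 i j k r s t : i != j -> i != k -> j != k ->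
  f i * r + f j * s + f k * t = 0 -> exists u v, r = f j * u + f k * v.
Proof.
move=> ij ik jk /(congr1 (eval1 k)); rewrite /eval1 !pushD push0 -/(eval1 k) !eval1M.
rewrite !eval1_fac eqxx ![k == _]eq_sym (negPf ik) (negPf jk) mul0r addr0.
move=> /(fac_regular2 ij) [u ru].
by exists u, (quo1 k r); rewrite {1}(eval1_quo1 k r) ru.
Qed.

End Koszul.

Lemma ord3P (P : 'I_3 -> Prop) : P 0 -> P 1 -> P 2%:R -> forall i, P i.
Proof.
move=> P0 P1 P2 [[|[|[|//]]] lti];
  [move: P0 | move: P1 | move: P2]; congr (P _); exact: val_inj.
Qed.

Lemma big_ord3 (V : nmodType) (F : 'I_3 -> V) :
  \sum_(i < 3) F i = F 0 + F 1 + F 2%:R.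
Proof.
rewrite !big_ord_recl big_ord0 addr0 addrA.
by congr (_ + F _ + F _); exact: val_inj.
Qed.

(** * Exactness of the Koszul complex in matrix form *)

Section KoszulMatrices.
Variable M : laurent_model.

Definition mx_of_seq m n (s : seq (seq M)) : 'M[M]_(m, n) :=
  \matrix_(i, j) nth 0 (nth [::] s i) j.

Definition fac_col (b : bool) : 'cV[M]_3 :=
  mx_of_seq _ _ [:: [:: fac M b 0]; [:: fac M b 1]; [:: fac M b 2%:R]].

(* The middle Koszul differential; signs are irrelevant in characteristic 2. *)
Definition fac_mx (b : bool) : 'M[M]_3 :=
  mx_of_seq _ _ [:: [:: 0; fac M b 2%:R; fac M b 1];
                    [:: fac M b 2%:R; 0; fac M b 0];
                    [:: fac M b 1; fac M b 0; 0]].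

Let expand := (mxE, big_ord3, big_ord1, mul0r, mulr0, add0r, addr0).

Lemma fac_mx_col b : fac_mx b *m fac_col b = 0.
Proof.
apply/colP; apply: ord3P; rewrite !expand /= ?expand.
- by rewrite [_ * fac M b 2%:R]mulrC lm_addrr.
- by rewrite [_ * fac M b 2%:R]mulrC lm_addrr.
- by rewrite [_ * fac M b 1]mulrC lm_addrr.
Qed.

Lemma fac_mx_tr b : (fac_mx b)^T = fac_mx b.
Proof.
by apply/matrixP; apply: ord3P; apply: ord3P; rewrite !mxE.
Qed.

Lemma fac_row_mx b : (fac_col b)^T *m fac_mx b = 0.
Proof. by rewrite -[fac_mx b]fac_mx_tr -trmx_mul fac_mx_col trmx0. Qed.

Local Notation f := (fac M false).

(** Exactness at [K_2]: regularity extracts a factor [t] from one coordinate, and cancelling [f 0]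
    in the remaining equations forces the same factor in the others. *)
Lemma ker_fac_mx (v : 'cV[M]_3) :
  fac_mx false *m v = 0 -> exists z : 'cV_1, v = fac_col false *m z.
Proof.
move=> /colP e.
move: (e 0) (e 1) (e 2%:R); rewrite !mxE !big_ord3 !mxE /= !expand => _ e1 e2.
have [//|t v0] := @fac_regular2 M 2%:R 0 (v 0 0) (v 2%:R 0) _ e1.
exists (t%:M); apply/colP; apply: ord3P;
  rewrite !mxE big_ord1 !mxE /= mulr1n //.
- by apply: subr0_eq; apply: (@fac_inj M 0); rewrite lm_oppr -[RHS]e2 v0; ring.
- by apply: subr0_eq; apply: (@fac_inj M 0); rewrite lm_oppr -[RHS]e1 v0; ring.
Qed.

(** Exactness at [K_1]: first [v_2 = f_0 a + f_1 b]. Substituting leaves a relation between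
    [v_0 + f_2 a] and [v_1 + f_2 b], solved by regularity of two elements with a factor [c]. *)
Lemma ker_fac_row (v : 'cV[M]_3) :
  (fac_col false)^T *m v = 0 -> exists w : 'cV_3, v = fac_mx false *m w.
Proof.
move=> /colP /(_ 0); rewrite !mxE big_ord3 !mxE /= => e.
have [|a [b v2]] :=
  @fac_regular3 M 2%:R 0 1 (v 2%:R 0) (v 0 0) (v 1 0) isT isT isT.
  by rewrite -[RHS]e; ring.
have [|c v1] :=
  @fac_regular2 M 1 0 (v 1 0 + f 2%:R * b) (v 0 0 + f 2%:R * a) isT.
  by rewrite -[RHS]e v2; ring.
have v0 : v 0 0 + f 2%:R * a = f 1 * c.
  apply: subr0_eq; apply: (@fac_inj M 0); rewrite lm_oppr.
  by rewrite -[RHS]e v2 mulrDr mulrCA -v1; ring.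
(* The order [b, a, c] matches the columns of [fac_mx]: its last row must give [f_1 b + f_0 a]. *)
exists (mx_of_seq _ _ [:: [:: b]; [:: a]; [:: c]]); apply/colP; apply: ord3P;
  rewrite !mxE big_ord3 !mxE /= !expand.
- by rewrite -v0 addrCA addrA lm_addrK2.
- by rewrite -v1 addrCA addrA lm_addrK2.
- by rewrite v2 addrC.
Qed.

End KoszulMatrices.

(** * The null homotopy of the twist and the resulting shears *)

Section TwistedCode.
Variable M : laurent_model.
Implicit Types c : 'cV['F_2]_3.

(** Component [c l] sits at the pair of [l] and its cyclic predecessor [l - 1], and [dir] assigns to
    this pair the direction [l - 1]. Diagonal weights are zero, so the diagonal of [dir] is
    arbitrary. *)
Definition wt c (k i : 'I_3) : 'F_2 :=
  nth 0 (nth [::] [:: [:: 0; c 1 0; c 0 0];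
                      [:: c 1 0; 0; c 2%:R 0];
                      [:: c 0 0; c 2%:R 0; 0]] k) i.

Definition dir (k i : 'I_3) : 'I_3 :=
  nth 0 (nth [::] [:: [:: 0; 0; 2%:R]; [:: 0; 0; 1]; [:: 2%:R; 1; 0]] k) i.

Lemma wtC c k i : wt c k i = wt c i k.
Proof. by move: k i; apply: ord3P; apply: ord3P. Qed.

Lemma dirC k i : dir k i = dir i k.
Proof. by move: k i; apply: ord3P; apply: ord3P. Qed.

(* Multiplication by [c] is a chain map of degree [-2] on the Koszul complex;
   [hcol] and [gcol] form a null homotopy of it, built from [hop] because
   [hop b i] is a homotopy between [0] and the identity on the factor [i]. *)
Definition hcol (b : bool) c (p : 'cV[M]_3) : 'cV[M]_3 :=
  \col_k \sum_i cst M (wt c k i) * hop b (dir k i) (p i 0).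

Definition gcol (b : bool) c (z : 'cV[M]_1) : 'cV[M]_3 :=
  mx_of_seq _ _ [:: [:: cst M (c 2%:R 0) * hop b 1 (z 0 0)];
                    [:: cst M (c 0 0) * hop b 2%:R (z 0 0)];
                    [:: cst M (c 1 0) * hop b 0 (z 0 0)]].

Definition cst_col c : 'cV[M]_3 := map_mx (cst M) c.

(** In row [k] one entry of [hcol] hops along the very factor it meets, and [hop_fac] yields an
    extra [c_k z] that cancels the twist. The other entry commutes with its factor, and the rest is
    [fac_mx] applied to [gcol]. *)
Lemma koszul_homotopy b c z :
  cst_col c *m z + hcol b c (fac_col M b *m z) = fac_mx M b *m gcol b c z.
Proof.
have sc0 : cst M 0 = 0 by [].
apply/colP; apply: ord3P; rewrite !mxE !big_ord1 !big_ord3 !mxE !big_ord1 !mxE /=;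
  rewrite /wt /dir !hop_fac /= !(mulr0n, mulr1n, sc0, mul0r, add0r, addr0) (ord1 ord0).
(* The cancelling pair is added on the right, so that [ring] closes the goal without knowing the
   characteristic. *)
- rewrite -[RHS]addr0 -(lm_addrr (cst M (c 0 0) * z 0 0)); ring.
- rewrite -[RHS]addr0 -(lm_addrr (cst M (c 1 0) * z 0 0)); ring.
- rewrite -[RHS]addr0 -(lm_addrr (cst M (c 2%:R 0) * z 0 0)); ring.
Qed.

Lemma hcolD b c : {morph hcol b c : p q / p + q}.
Proof.
move=> p q; apply/colP => k; rewrite !mxE -big_split; apply: eq_bigr => i _ /=.
by rewrite mxE hopD mulrDr.
Qed.

Lemma gcolD b c : {morph gcol b c : p q / p + q}.
Proof.
move=> p q; apply/colP; apply: ord3P; rewrite !mxE /= hopD mulrDr //.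
Qed.

Lemma hcol_Lambda b c n p : in_Lambda n ->
  hcol b c (mono M n *: p) = mono M n *: hcol b c p.
Proof.
move=> Ln; apply/colP => k; rewrite !mxE big_distrr; apply: eq_bigr => i _ /=.
by rewrite mxE hop_Lambda // mulrCA.
Qed.

Lemma gcol_Lambda b c n z : in_Lambda n ->
  gcol b c (mono M n *: z) = mono M n *: gcol b c z.
Proof.
move=> Ln; apply/colP; apply: ord3P; rewrite !mxE /= hop_Lambda // mulrCA //.
Qed.

Definition codeX c : 'M[M]_(3 + 3, 1 + 3) :=
  block_mx (fac_col M true) 0 (cst_col c) (fac_mx M true).

Definition codeZ c : 'M[M]_(3 + 3, 3 + 1) :=
  block_mx (fac_mx M false) (cst_col c) 0 (fac_col M false).

Definition codeX_dag c : 'M[M]_(1 + 3, 3 + 3) :=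
  block_mx (fac_col M false)^T (cst_col c)^T 0 (fac_mx M false).

Lemma mx_addrr m n (A : 'M[M]_(m, n)) : A + A = 0.
Proof. by apply/matrixP => i j; rewrite !mxE lm_addrr. Qed.

Lemma cst_row_fac c :
  (fac_col M false)^T *m cst_col c = (cst_col c)^T *m fac_col M false.
Proof.
apply/matrixP => i j; rewrite !ord1 !mxE; apply: eq_bigr => k _.
by rewrite [in LHS]mxE [in RHS]mxE mulrC.
Qed.

(** The lower block is exact at [K_2] and gives [k = f z]. The upper equation then says that
    [u + c z] is in the kernel of the row of the [f i], so exactness at [K_1] applies. *)
Lemma codeX_dag_exact c (v : 'cV[M]_(3 + 3)) :
  codeX_dag c *m v = 0 <-> exists w, v = codeZ c *m w.
Proof.
rewrite -[v]vsubmxK; set u := usubmx v; set k := dsubmx v.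
rewrite mul_block_col mul0mx add0r -[0]col_mx0.
split=> [/eq_col_mx [e1 /ker_fac_mx [z kz]]|[w]].
  have /ker_fac_row [y uy] : (fac_col M false)^T *m (u + cst_col c *m z) = 0.
    by rewrite mulmxDr mulmxA cst_row_fac -mulmxA -kz.
  exists (col_mx y z); rewrite mul_block_col mul0mx add0r -kz -uy.
  by rewrite -addrA mx_addrr addr0.
rewrite -[w]vsubmxK mul_block_col mul0mx add0r => /eq_col_mx [-> ->].
rewrite mulmxDr !mulmxA fac_row_mx fac_mx_col !mul0mx add0r.
by rewrite -cst_row_fac mx_addrr.
Qed.

Section Shear.
Variables (m n : nat) (F : 'cV[M]_m -> 'cV[M]_n).

(** A CNOT network controlled by the upper block; in characteristic 2 it is its own inverse. *)
Definition shear_down (v : 'cV[M]_(m + n)) : 'cV[M]_(m + n) :=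
  col_mx (usubmx v) (dsubmx v + F (usubmx v)).

Definition shear_up (v : 'cV[M]_(n + m)) : 'cV[M]_(n + m) :=
  col_mx (usubmx v + F (dsubmx v)) (dsubmx v).

Lemma shear_downK : involutive shear_down.
Proof.
move=> v; rewrite /shear_down col_mxKu col_mxKd -addrA mx_addrr addr0.
exact: vsubmxK.
Qed.

Lemma shear_upK : involutive shear_up.
Proof.
move=> v; rewrite /shear_up col_mxKu col_mxKd -addrA mx_addrr addr0.
exact: vsubmxK.
Qed.

Hypothesis FD : {morph F : p q / p + q}.

Lemma shear_downD : {morph shear_down : p q / p + q}.
Proof.
by move=> p q; rewrite /shear_down add_col_mx !linearD /= FD addrACA.
Qed.

End Shear.

(** The shear adds [hcol] of [f p] to the twist term, and the homotopy rewrites the sum as [fac_mx]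
    of [gcol p]; this is absorbed by a change of generators. *)
Lemma shear_codeX c w :
  shear_down (hcol true c) (codeX c *m w) =
  codeX 0 *m shear_down (gcol true c) w.
Proof.
rewrite -[w]vsubmxK; set p := usubmx w; set q := dsubmx w.
rewrite /shear_down !mul_block_col !col_mxKu !col_mxKd !mul0mx !addr0.
congr col_mx.
rewrite mulmxDr -koszul_homotopy /cst_col.
have -> : map_mx (cst M) 0 = 0 :> 'cV_3 by apply/colP => i; rewrite !mxE.
by rewrite mul0mx add0r addrAC addrC addrCA addrA.
Qed.

(** The Z-side uses the same homotopy for the unconjugated complex. CNOTs act on Z-type operators by
    the transpose, hence the upper shear. *)
Lemma shear_codeZ c w :
  shear_up (hcol false c) (codeZ c *m w) =
  codeZ 0 *m shear_up (gcol false c) w.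
Proof.
rewrite -[w]vsubmxK; set p := usubmx w; set q := dsubmx w.
rewrite /shear_up !mul_block_col !col_mxKu !col_mxKd !mul0mx !add0r.
congr col_mx.
rewrite mulmxDr -koszul_homotopy /cst_col.
have -> : map_mx (cst M) 0 = 0 :> 'cV_3 by apply/colP => i; rewrite !mxE.
by rewrite mul0mx addr0 addrA.
Qed.

Lemma shear_codeX_inv c w :
  shear_down (hcol true c) (codeX c *m shear_down (gcol true c) w) = codeX 0 *m w.
Proof. by rewrite shear_codeX shear_downK. Qed.

Lemma shear_codeZ_inv c w :
  shear_up (hcol false c) (codeZ c *m shear_up (gcol false c) w) = codeZ 0 *m w.
Proof. by rewrite shear_codeZ shear_upK. Qed.

End TwistedCode.

(** * Blocking *)

(** Factors [1 + N_ij E_ij] with [i] in [P] and [j] outside [P] multiply without cross terms,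
    because no column index is also a row index. *)
Lemma elementary_sum (A : comNzRingType) n (P : pred 'I_n)
    (l : seq ('I_n * 'I_n)) (N : 'M[A]_n) :
  (forall p, p \in l -> P p.1 && ~~ P p.2) ->
  elementary (1%:M + \sum_(p <- l) N p.1 p.2 *: delta_mx p.1 p.2).
Proof.
elim: l => [|[i j] l IH] Pl; first by rewrite big_nil addr0; exact: elementary1.
have /andP [/= Pi nPj] := Pl (i, j) (mem_head _ _).
have el : forall p, p \in l -> P p.1 && ~~ P p.2.
  by move=> p pl; apply: Pl; rewrite inE pl orbT.
have {}el := IH el.
have ij : i != j by apply: contraNneq nPj => <-.
set S := \sum_(p <- l) _ in el *; rewrite big_cons -/S /=.
have dS0 : N i j *: delta_mx i j *m S = 0.
  rewrite /S mulmx_sumr big_seq big1 // => p pl.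
  rewrite -scalemxAl -scalemxAr mul_delta_mx_0 ?scaler0 //.
  have /andP [Pp _] : P p.1 && ~~ P p.2 by apply: Pl; rewrite inE pl orbT.
  by apply: contraNneq nPj => ->.
have := elementaryM (elementary_gen (N i j) ij) el.
by rewrite mulmxDl mul1mx mulmxDr mulmx1 dS0 addr0 -addrA [S + _]addrC.
Qed.

Lemma elementary_block (A : comNzRingType) n (P : pred 'I_n) (N : 'M[A]_n) :
  (forall i j, ~~ (P i && ~~ P j) -> N i j = 0) -> elementary (1%:M + N).
Proof.
move=> N0.
have -> : N = \sum_(p <- enum [pred p : 'I_n * 'I_n | P p.1 && ~~ P p.2])
    N p.1 p.2 *: delta_mx p.1 p.2.
  rewrite {1}[N]matrix_sum_delta pair_big /= big_enum [RHS]big_mkcond /=.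
  apply: eq_bigr => p _; case: ifP => // /negbT /N0 ->; exact: scale0r.
apply: (elementary_sum (P := P)) => p; by rewrite mem_enum.
Qed.

Lemma forall_ord3 (P : pred 'I_3) : [forall i, P i] = [&& P 0, P 1 & P 2%:R].
Proof.
apply/idP/idP => [/forallP h|/and3P [h0 h1 h2]]; first by rewrite !h.
apply/forallP; exact: (@ord3P (fun i => P i) h0 h1 h2).
Qed.

(** The corner of [m] is the number whose binary digits are the parities of its coordinates. *)
Lemma corner_spec (m : lattice) :
  exists e, forall e', in_Lambda (m - corner e') = (e' == e).
Proof.
pose p (i : 'I_3) := ~~ (2 %| m ord0 i)%Z.
have h i e' : (2 %| (m - corner e') ord0 i)%Z = (p i == odd (e' %/ 2 ^ i)).
  rewrite /p !mxE modn2 !dvdzE; case: odd => /=; lia.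
exists (inord (p 0%R + p 1%R * 2 + p 2%:R%R * 4)) => e'.
rewrite /in_Lambda forall_ord3 !h -val_eqE /= inordK; last by do 3!case: (p _).
by do 3!case: (p _); case: e' => [[|[|[|[|[|[|[|[|//]]]]]]]] ?].
Qed.

(** * Matrices of maps linear over the blocked ring *)

Section Blocking.
Variables (M : laurent_model) (A : comNzRingType) (inc : {rmorphism A -> M}).
Hypothesis inc_inj : injective inc.
Hypothesis inc_ind : forall P : M -> Prop,
  P 0 -> (forall m, in_Lambda m -> P (mono M m)) ->
  (forall r s, P r -> P s -> P (r + s)) -> forall x, P (inc x).
Variable coord : 'I_8 -> M -> A.
Hypothesis inc_coord : forall e r, inc (coord e r) =
  mlift (fun m => if in_Lambda (m - corner e) then mono M (m - corner e) else 0) r.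

Lemma coordD e : {morph coord e : r s / r + s}.
Proof. by move=> r s; apply: inc_inj; rewrite rmorphD !inc_coord mliftD. Qed.

Lemma coord0 e : coord e 0 = 0.
Proof. by apply: (addrI (coord e 0)); rewrite -coordD !addr0. Qed.

Lemma coordM e x r : coord e (inc x * r) = x * coord e r.
Proof.
apply: inc_inj; rewrite rmorphM !inc_coord; set phi := fun m => _.
move: x r; apply: (inc_ind (P := fun y => forall r, mlift phi (y * r) = y * mlift phi r))
  => [r|n Ln r|y z IHy IHz r].
- by rewrite !mul0r mlift0.
- elim/lm_ind: r => [|m|r s IHr IHs].
  + by rewrite mulr0 !mlift0 mulr0.
  + rewrite -monoD !mlift_mono /phi -addrA.
    have -> : in_Lambda (n + (m - corner e)) = in_Lambda (m - corner e).
      apply: eq_forallb => i; rewrite mxE rpredDl //; exact: (forallP Ln).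
    by case: (in_Lambda (m - corner e)); [exact: monoD | rewrite mulr0].
  + by rewrite mulrDr !mliftD IHr IHs mulrDr.
- by rewrite !mulrDl mliftD IHy IHz.
Qed.

Lemma coord_corner e e' : coord e' (mono M (corner e)) = (e' == e)%:R.
Proof.
apply: inc_inj; rewrite inc_coord mlift_mono rmorph_nat.
have [e0 He0] := corner_spec (corner e).
have /eqP ee0 : e == e0.
  by rewrite -He0 subrr; apply/forallP => i; rewrite mxE.
rewrite He0 -ee0; case: eqP => [->|//]; by rewrite subrr mono0.
Qed.

Lemma coord_sum r : r = \sum_e inc (coord e r) * mono M (corner e).
Proof.
elim/lm_ind: r => [|m|r s IHr IHs].
- by rewrite big1 // => e _; rewrite coord0 rmorph0 mul0r.
- have [e0 He0] := corner_spec m.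
  rewrite (bigD1 e0) //= big1 => [|e /negPf ne].
    by rewrite inc_coord mlift_mono He0 eqxx -monoD subrK addr0.
  by rewrite inc_coord mlift_mono He0 ne mul0r.
- rewrite {1}IHr {1}IHs -big_split; apply: eq_bigr => e _ /=.
  by rewrite coordD rmorphD mulrDl.
Qed.

(** Testing on even monomials suffices: [Lambda_linearZ] extends linearity to all of [A] through
    [inc_ind]. *)
Definition Lambda_linear m n (F : 'cV[M]_m -> 'cV[M]_n) : Prop :=
  {morph F : p q / p + q} /\
  forall k p, in_Lambda k -> F (mono M k *: p) = mono M k *: F p.

Section LambdaLinear.
Variables (m n : nat) (F : 'cV[M]_m -> 'cV[M]_n).
Hypothesis F_lin : Lambda_linear F.

Lemma Lambda_linear0 : F 0 = 0.
Proof. by apply: (addrI (F 0)); rewrite -(proj1 F_lin) !addr0. Qed.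

Lemma Lambda_linear_sum (I : Type) (l : seq I) (E : I -> 'cV[M]_m) :
  F (\sum_(i <- l) E i) = \sum_(i <- l) F (E i).
Proof. exact: (big_morph F (proj1 F_lin) Lambda_linear0). Qed.

Lemma Lambda_linearZ x p : F (inc x *: p) = inc x *: F p.
Proof.
move: x; apply: (inc_ind (P := fun y => F (y *: p) = y *: F p))
  => [|k Lk|y z IHy IHz].
- by rewrite !scale0r Lambda_linear0.
- exact: (proj2 F_lin).
- by rewrite !scalerDl (proj1 F_lin) IHy IHz.
Qed.

End LambdaLinear.

(* The matrix over [A] of a map that is linear over [inc A], in the bases
   [mono (corner e)] of each coordinate. *)
Definition blkop m n (F : 'cV[M]_m -> 'cV[M]_n) :
    'M[A]_(\sum_(i < n) 8, \sum_(k < m) 8) :=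
  \mxblock_(i < n, k < m)
    \matrix_(e', e) coord e' (F (mono M (corner e) *: delta_mx k 0) i 0).

Lemma eq_blkop m n (F G : 'cV[M]_m -> 'cV[M]_n) : F =1 G -> blkop F = blkop G.
Proof.
by move=> FG; apply: eq_mxblock => i k; apply/matrixP => e' e; rewrite !mxE FG.
Qed.

(** Each column of [G] is expanded in the corner basis, and the coefficients from [A] pass through
    [F] and [coord]. *)
Lemma blkop_comp m n p (F : 'cV[M]_n -> 'cV[M]_p) (G : 'cV[M]_m -> 'cV[M]_n) :
  Lambda_linear F -> blkop (F \o G) = blkop F *m blkop G.
Proof.
move=> F_lin; rewrite mul_mxblock; apply: eq_mxblock => i k.
apply/matrixP => e'' e; rewrite mxE summxE /=.
set v := G _.
have -> : v = \sum_j \sum_e'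
    inc (coord e' (v j 0)) *: (mono M (corner e') *: delta_mx j 0).
  rewrite {1}[v]matrix_sum_delta; apply: eq_bigr => j _.
  rewrite big_ord1 {1}(coord_sum (v j 0)) scaler_suml.
  by apply: eq_bigr => e' _; rewrite scalerA.
rewrite Lambda_linear_sum // summxE (big_morph _ (coordD e'') (coord0 e'')).
apply: eq_bigr => j _; rewrite Lambda_linear_sum // summxE mxE.
rewrite (big_morph _ (coordD e'') (coord0 e'')); apply: eq_bigr => e' _.
by rewrite (Lambda_linearZ F_lin) [in LHS]mxE coordM [in RHS]mxE
  [in X in _ = _ * X]mxE mulrC.
Qed.

Lemma blkopD m n (F G : 'cV[M]_m -> 'cV[M]_n) :
  blkop (fun v => F v + G v) = blkop F + blkop G.
Proof.
rewrite -mxblockD; apply: eq_mxblock => i k; apply/matrixP => e' e.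
by rewrite !mxE coordD.
Qed.

Lemma blkop_id n : blkop (fun v : 'cV[M]_n => v) = 1%:M.
Proof.
apply/matrixP => s t; rewrite !mxE andbT.
have -> : (s == t) = (tagnat.sig1 s == tagnat.sig1 t) &&
    (tagnat.sig2 s == tagnat.sig2 t :> nat).
  by rewrite -{1}[s]tagnat.sig2K -{1}[t]tagnat.sig2K -val_eqE tagnat.eq_Rank.
case: eqP => _; last by rewrite mulr0 coord0.
by rewrite mulr1 coord_corner.
Qed.

Lemma blkop_mulmx m n (phi : 'M[M]_(n, m)) :
  blkop (mulmx phi) = \mxblock_(i < n, k < m)
    \matrix_(e', e) coord e' (phi i k * mono M (corner e)).
Proof.
apply: eq_mxblock => i k; apply/matrixP => e' e; rewrite !mxE; congr coord.
rewrite (bigD1 k) //= big1 => [|j /negPf jk]; rewrite !mxE ?eqxx ?addr0 ?mulr1 //.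
by rewrite jk !mulr0.
Qed.

Lemma Lambda_linear_shear m n (F : 'cV[M]_m -> 'cV[M]_n) :
  Lambda_linear F -> Lambda_linear (shear_down F).
Proof.
move=> [FD FZ]; split=> [|k p Lk]; first exact: shear_downD.
by rewrite /shear_down !linearZ /= FZ // scale_col_mx scalerDr.
Qed.

(** Beyond the identity, a shear has entries only in rows of the lower block and columns of the
    upper block, so [elementary_block] applies. *)
Lemma elementary_shear m n (F : 'cV[M]_m -> 'cV[M]_n) :
  F 0 = 0 -> elementary (blkop (shear_down F)).
Proof.
move=> F0.
have shearE v : shear_down F v = v + col_mx 0 (F (usubmx v)).
  by rewrite -{2}[v]vsubmxK add_col_mx addr0.
rewrite (eq_blkop shearE) blkopD blkop_id.
pose lower (s : 'I_(\sum_(i < m + n) 8)) := (m <= tagnat.sig1 s)%N.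
apply: (@elementary_block _ _ lower) => s t.
rewrite negb_and negbK /lower !mxE -ltnNge => /orP [sm|tm].
  by case: splitP => j e; [rewrite mxE coord0 | move: sm; rewrite e ltnNge leq_addr].
have -> : usubmx (mono M (corner (tagnat.sig2 t)) *: delta_mx (tagnat.sig1 t) 0
    : 'cV[M]_(m + n)) = 0.
  apply/colP => j; rewrite !mxE andbT -val_eqE /=.
  by rewrite ltn_eqF ?mulr0 //; apply: leq_trans tm.
rewrite F0; case: splitP => j _; rewrite mxE coord0 //.
Qed.

Lemma inGL_involution n (F : 'cV[M]_n -> 'cV[M]_n) :
  Lambda_linear F -> involutive F -> inGL (blkop F).
Proof.
move=> F_lin FK; exists (blkop F); rewrite -blkop_comp //.
by rewrite (eq_blkop (G := fun v => v)) // blkop_id.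
Qed.

(** [W] is the shear by [hcol] and [Phi] the shear by [gcol]; since [Phi] is an involution, the
    intertwining relation becomes [W phi Phi = phi']. *)
Lemma cl_equiv_codeX c :
  cl_equiv (blkop (mulmx (codeX M c))) (blkop (mulmx (codeX M 0))).
Proof.
have hL : Lambda_linear (hcol (M := M) true c).
  by split=> [p r|k p Lk]; rewrite ?hcolD ?hcol_Lambda.
have gL : Lambda_linear (gcol (M := M) true c).
  by split=> [p r|k p Lk]; rewrite ?gcolD ?gcol_Lambda.
exists (blkop (shear_down (hcol true c))), (blkop (shear_down (gcol true c))).
split; first exact/elementary_shear/Lambda_linear0/hL.
  exact/inGL_involution/shear_downK/Lambda_linear_shear.
rewrite -!blkop_comp; first apply: eq_blkop => w /=.
- by rewrite shear_codeX shear_downK.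
- split=> [p r|k p Lk] /=.
    by rewrite mulmxDr (proj1 (Lambda_linear_shear hL)).
  by rewrite -scalemxAr (proj2 (Lambda_linear_shear hL)).
- exact: Lambda_linear_shear.
Qed.

End Blocking.

(** * Circuits acting on cells *)

Section CellCircuit.
Variables (K : numClosedFieldType) (q : nat).
Implicit Types (s : config q) (j : qubit q) (c : lattice) (l : seq lattice).

(** Division rounds down, so the fibres are the 2x2x2 cells, also at negative coordinates. *)
Definition halve (m : lattice) : lattice := \row_i (m ord0 i %/ 2)%Z.

Definition cell_of j : lattice := halve j.1.

Definition cell c : {fset qubit q} :=
  seq_fset tt [seq (corner e + c *+ 2, i) | e <- enum 'I_8, i <- enum 'I_q].

Lemma halve_corner e c : halve (corner e + c *+ 2) = c.
Proof.
apply/rowP => i; rewrite [c *+ 2]mulr2n -[c 0 i]/(c ord0 i) !mxE modn2.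
by case: odd => /=; lia.
Qed.

Lemma in_cell c j : (j \in cell c) = (cell_of j == c).
Proof.
rewrite /cell seq_fsetE; apply/allpairsP/eqP => [[[e i] [_ _ ->]]|jc].
  exact: halve_corner.
have [e He] := corner_spec j.1; exists (e, j.2); split; rewrite ?mem_enum //.
rewrite [LHS]surjective_pairing /=; congr pair; apply/rowP => i.
have /forallP /(_ i) : in_Lambda (j.1 - corner e) by rewrite He eqxx.
rewrite -jc [_ *+ 2]mulr2n -[j.1 0 i]/(j.1 ord0 i) !mxE modn2.
by case: odd => /=; lia.
Qed.

Lemma patch_restr (S : {fset qubit q}) s s' j :
  patch s (restr S s') j = if j \in S then s' j else s j.
Proof.
rewrite /patch; case: insubP => [k -> <-|/negPf -> //]; by rewrite ffunE.
Qed.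

Section Kernel.
Variables (S : {fset qubit q}) (k : {ffun S -> 'F_2} -> {ffun S -> 'F_2} -> K).

Definition kernel_mx : 'M[K]_#|{ffun S -> 'F_2}| :=
  \matrix_(x, y) k (enum_val x) (enum_val y).

Lemma on_support_kernel (psi : wave K q) s :
  on_support kernel_mx psi s =
  \sum_t k (restr S s) t * psi (patch s t).
Proof. by apply: eq_bigr => t _; rewrite mxE !enum_rankK. Qed.

End Kernel.

Lemma on_support_delta (S : {fset qubit q}) (g : {ffun S -> 'F_2} -> {ffun S -> 'F_2})
    (b : {ffun S -> 'F_2} -> K) (psi : wave K q) s :
  on_support (kernel_mx (fun t t' => b t *+ (t' == g t))) psi s =
  b (restr S s) * psi (patch s (g (restr S s))).
Proof.
rewrite on_support_kernel (bigD1 (g (restr S s))) //= eqxx big1 ?addr0 // => t.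
by move=> /negPf ->; rewrite mulr0n mul0r.
Qed.

Variable f : config q -> config q.
Hypothesis f_local : forall s s' j,
  (forall j', cell_of j' = cell_of j -> s j' = s' j') -> f s j = f s' j.
Hypothesis fK : involutive f.

(** The finite product of the gates of the cells in [l]; [f] itself is the infinite product. *)
Definition on_cells l s : config q := fun j => if cell_of j \in l then f s j else s j.

Lemma on_cells_cat c l s : c \notin l ->
  on_cells [:: c] (on_cells l s) = on_cells (c :: l) s /\
  on_cells l (on_cells [:: c] s) = on_cells (c :: l) s.
Proof.
move=> cl; split; apply: functional_extensionality => j; rewrite /on_cells !inE.
  case: eqP => //= jc; apply: f_local => j' ->.
  by rewrite jc (negPf cl).
case: ifP => jl; last by rewrite orbF.
rewrite orbT; apply: f_local => j' ->; rewrite !inE.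
by case: eqP => // jc; rewrite jc (negPf cl) in jl.
Qed.

Lemma on_cellsK l : involutive (on_cells l).
Proof.
move=> s; apply: functional_extensionality => j; rewrite /on_cells.
case: (boolP (cell_of j \in l)) => // jl; rewrite -[RHS](congr1 (@^~ j) (fK s)).
by apply: f_local => j' ->; rewrite jl.
Qed.

(** Padding by zero outside the cell is harmless: by locality the values of [f] on the cell depend
    only on [t]. *)
Definition cell_perm c (t : {ffun cell c -> 'F_2}) : {ffun cell c -> 'F_2} :=
  restr (cell c) (f (patch (fun=> 0) t)).

Lemma patch_cell_perm c s :
  patch s (cell_perm (restr (cell c) s)) = on_cells [:: c] s.
Proof.
apply: functional_extensionality => j.
rewrite patch_restr in_cell /on_cells inE; case: eqP => // jc.
by apply: f_local => j' jj; rewrite patch_restr in_cell jj jc eqxx.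
Qed.

Lemma restr_patch (S : {fset qubit q}) s t : restr S (patch s t) = t.
Proof. by apply/ffunP => k; rewrite ffunE /patch valK. Qed.

Lemma cell_permK c : involutive (@cell_perm c).
Proof.
move=> t; apply/ffunP => k; rewrite ffunE.
rewrite -[RHS](congr1 (fun t' : {ffun cell c -> 'F_2} => t' k) (restr_patch (fun=> 0) t)).
rewrite [RHS]ffunE -[in RHS](fK (patch _ t)); apply: f_local => j jk.
have : val k \in cell c by exact: valP.
by rewrite patch_restr !in_cell jk => ->.
Qed.

Definition cell_mx c : 'M[K]_#|{ffun cell c -> 'F_2}| :=
  kernel_mx (fun t t' => 1 *+ (t' == cell_perm t)).

(** The permutation matrix of an involution is real and symmetric. *)
Lemma cell_mx_adjoint c : (map_mx Num.conj (cell_mx c))^T = cell_mx c.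
Proof.
apply/matrixP => x y; rewrite !mxE conjC_nat; congr (_%:R).
by rewrite eq_sym (inv_eq (@cell_permK c)).
Qed.

Lemma cell_mx_unitary c : cell_mx c \is unitarymx.
Proof.
apply/unitarymxP; rewrite -map_trmx cell_mx_adjoint; apply/matrixP => x y; rewrite !mxE.
rewrite (bigD1 (enum_rank (cell_perm (enum_val x)))) //= big1 => [|z zx].
  rewrite !mxE enum_rankK eqxx mul1r addr0 cell_permK eq_sym.
  by rewrite (inj_eq enum_val_inj).
rewrite !mxE; case: eqP => [e|]; last by rewrite mul0r.
by rewrite -e enum_valK eqxx in zx.
Qed.

Definition cell_gate c : gate K q := Gate (cell_mx_unitary c).

Lemma cell_gate_conj c (O : operator K q) :
  gate_conj (cell_gate c) O =
  fun psi s => O (fun s' => psi (on_cells [:: c] s')) (on_cells [:: c] s).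
Proof.
have cellE psi s : on_support (cell_mx c) psi s = psi (on_cells [:: c] s).
  by rewrite on_support_delta mul1r patch_cell_perm.
apply: functional_extensionality => psi; apply: functional_extensionality => s.
rewrite /gate_conj /= cell_mx_adjoint cellE; congr (O _ _).
by apply: functional_extensionality => s'; rewrite cellE.
Qed.

Lemma cell_gate_disjoint c d : c != d ->
  [disjoint gsupp (cell_gate c) & gsupp (cell_gate d)]%fset.
Proof.
move=> cd; apply/fdisjointP => j; rewrite !in_cell => /eqP ->; exact: cd.
Qed.

Lemma cell_gate_range : exists r : int, forall c j j',
  j \in gsupp (cell_gate c) -> j' \in gsupp (cell_gate c) ->
  forall k, `|j.1 0 k - j'.1 0 k| <= r.
Proof.
(* Two sites of one cell differ by at most 1 in each coordinate. *)
exists 1 => c j j'; rewrite !in_cell => /eqP jc /eqP jc' k.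
have : halve j.1 0 k = halve j'.1 0 k by rewrite -/(cell_of j) jc -jc'.
rewrite !mxE -[j.1 0 k]/(j.1 ord0 k) -[j'.1 0 k]/(j'.1 ord0 k); lia.
Qed.

Definition cell_layer : layer K q := Layer cell_gate_disjoint cell_gate_range.

Definition conj_cells l (O : operator K q) : operator K q :=
  fun psi s => O (fun s' => psi (on_cells l s')) (on_cells l s).

Lemma foldr_cell_gate l (O : operator K q) : uniq l ->
  foldr (fun c => gate_conj (cell_layer c)) O l = conj_cells l O.
Proof.
elim: l => [|c l IH] //= /andP [cl ul].
rewrite IH // [LHS]cell_gate_conj /conj_cells.
apply: functional_extensionality => psi; apply: functional_extensionality => s.
rewrite (proj2 (on_cells_cat s cl)); congr (O _ _).
by apply: functional_extensionality => s'; rewrite (proj1 (on_cells_cat s' cl)).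
Qed.

End CellCircuit.

(** * Conjugation of Pauli operators by the cell layer *)

Section PauliTracking.
Variables (K : numClosedFieldType) (q : nat).
Implicit Types (s u : config q) (j : qubit q) (S : {fset qubit q}).
Implicit Types (O P : operator K q) (v : 'cV[Laurent]_q).

(** A common form of X-type and Z-type operators that is closed under composition, which makes
    supports easy to follow. *)
Definition phase_shift (phi : config q -> K) u : operator K q :=
  fun psi s => phi s * psi (fun j => s j + u j).

Definition phase_shift_on S O : Prop := exists phi u,
  [/\ forall s s', (forall j, j \in S -> s j = s' j) -> phi s = phi s',
      forall j, j \notin S -> u j = 0
    & O = phase_shift phi u].

Lemma phase_shift_on_supported S O : phase_shift_on S O -> supported_in S O.
Proof.
move=> [phi [u [phiS uS ->]]].
pose g (t : {ffun S -> 'F_2}) := restr S (fun j => patch (fun=> 0) t j + u j).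
exists (kernel_mx (fun t t' => phi (patch (fun=> 0) t) *+ (t' == g t))).
apply: functional_extensionality => psi; apply: functional_extensionality => s.
rewrite on_support_delta /phase_shift; congr (_ * psi _).
  by apply: phiS => j jS; rewrite patch_restr jS.
apply: functional_extensionality => j; rewrite !patch_restr.
by case: (boolP (j \in S)) => // /uS ->; rewrite addr0.
Qed.

Lemma phase_shift_on_comp S S' O P : phase_shift_on S O -> phase_shift_on S' P ->
  phase_shift_on (S `|` S') (O \o P).
Proof.
move=> [phi [u [phiS uS ->]]] [chi [w [chiS wS ->]]].
exists (fun s => phi s * chi (fun j => s j + u j)), (fun j => u j + w j); split.
- move=> s s' ss'; rewrite (phiS s s')
    ?(chiS (fun j => s j + u j) (fun j => s' j + u j)) //.
    by move=> j jS; rewrite ss' // inE jS orbT.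
  by move=> j jS; rewrite ss' // inE jS.
- by move=> j; rewrite inE negb_or => /andP [/uS -> /wS ->]; rewrite addr0.
apply: functional_extensionality => psi; apply: functional_extensionality => s.
rewrite /phase_shift /= mulrA; congr (_ * psi _).
by apply: functional_extensionality => j; rewrite addrA.
Qed.

Definition cfg v : config q := fun j => gacoef j.1 (v j.2 0).

Definition parity v s : 'F_2 :=
  \sum_(i < q) \sum_(m <- gasupp (v i 0)) s (m, i).

Definition supp v : {fset qubit q} :=
  seq_fset tt [seq (m, i) | i <- enum 'I_q, m <- enum_fset (gasupp (v i 0))].

Lemma in_supp v j : (j \in supp v) = (j.1 \in gasupp (v j.2 0)).
Proof.
rewrite seq_fsetE; apply/allpairsPdep/idP => [[i [m [_ mi ->]]] //|jv].
by exists j.2, j.1; split; rewrite ?mem_enum //; case: j jv.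
Qed.

Lemma cfg_out v j : j \notin supp v -> cfg v j = 0.
Proof. by rewrite in_supp; exact: mcoeff_outdom. Qed.

Lemma parity_local v s s' :
  (forall j, j \in supp v -> s j = s' j) -> parity v s = parity v s'.
Proof.
move=> ss'; apply: eq_bigr => i _; rewrite big_seq [RHS]big_seq.
by apply: eq_bigr => m mi; apply: ss'; rewrite in_supp.
Qed.

Lemma pauliX_phase_shift v : pauliX v = phase_shift (fun=> 1) (cfg v).
Proof.
apply: functional_extensionality => psi; apply: functional_extensionality => s.
by rewrite /phase_shift mul1r.
Qed.

Lemma pauliZ_phase_shift v :
  pauliZ v = phase_shift (fun s => (-1) ^+ parity v s) (fun=> 0).
Proof.
apply: functional_extensionality => psi; apply: functional_extensionality => s.
rewrite /pauliZ /phase_shift; congr (_ * psi _); last first.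
  by apply: functional_extensionality => j; rewrite addr0.
set N := (\sum_(i < q) _)%N.
have -> : parity v s = N%:R.
  rewrite /N natr_sum; apply: eq_bigr => i _; rewrite natr_sum.
  by apply: eq_bigr => m _; rewrite natr_Zp.
by rewrite val_Fp_nat // modn2 signr_odd.
Qed.

Variable f : config q -> config q.
Hypothesis f_local : forall s s' j,
  (forall j', cell_of j' = cell_of j -> s j' = s' j') -> f s j = f s' j.
Hypothesis fK : involutive f.
Hypothesis fD : forall s s' j, f (fun j' => s j' + s' j') j = f s j + f s' j.

(** Conjugation must give the same result for every large enough finite set of cells, so that two
    factors of a product can share one set. *)
Definition tracks O O' : Prop := exists S,
  phase_shift_on S O /\
  exists l0 : seq lattice, forall l, uniq l -> {subset l0 <= l} -> conj_cells f l O = O'.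

Lemma tracks_id : tracks id id.
Proof.
exists fset0; split.
  exists (fun=> 1), (fun=> 0); split=> //.
  apply: functional_extensionality => psi; apply: functional_extensionality => s.
  rewrite /phase_shift mul1r; congr psi.
  by apply: functional_extensionality => j; rewrite addr0.
exists [::] => l _ _; rewrite /conj_cells.
apply: functional_extensionality => psi; apply: functional_extensionality => s.
by rewrite (on_cellsK f_local fK).
Qed.

Lemma tracks_comp O O' P P' :
  tracks O O' -> tracks P P' -> tracks (O \o P) (O' \o P').
Proof.
move=> [S [SO [l0 hO]]] [S' [SP [l1 hP]]]; exists (S `|` S'); split.
  exact: phase_shift_on_comp.
exists (l0 ++ l1) => l ul sub.
have <- : conj_cells f l O = O'.
  by apply: hO => // c cl; apply: sub; rewrite mem_cat cl.
have <- : conj_cells f l P = P'.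
  by apply: hP => // c cl; apply: sub; rewrite mem_cat cl orbT.
rewrite /conj_cells.
apply: functional_extensionality => psi; apply: functional_extensionality => s /=.
congr (O _ _); apply: functional_extensionality => s'.
by rewrite (on_cellsK f_local fK).
Qed.

Lemma tracks_circuit O O' :
  tracks O O' -> circuit_maps [:: cell_layer K f_local fK] O O'.
Proof.
move=> [S [SO [l0 hO]]]; exists O' => //.
(* The cells of [l0] stabilize the result; those of [S] are the ones that [layer_maps] requires. *)
pose l := undup (l0 ++ [seq cell_of j | j <- enum_fset S]).
exists S, l; split; first exact: phase_shift_on_supported.
- exact: undup_uniq.
- move=> c; apply: contraR; rewrite mem_undup mem_cat negb_or => /andP [_ cS].
  apply/fdisjointP => j; rewrite in_cell => /eqP jc; apply: contra cS => jS.
  by apply/mapP; exists j.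
- rewrite foldr_cell_gate ?undup_uniq // hO ?undup_uniq // => c cl.
  by rewrite mem_undup mem_cat cl.
Qed.

Lemma local_additive0 s j :
  (forall j', cell_of j' = cell_of j -> s j' = 0) -> f s j = 0.
Proof.
move=> s0; rewrite -[RHS](F2_addrr (f s j)) -fD.
by apply: f_local => j' /s0 ->; rewrite addr0.
Qed.

Definition supp_cells v : seq lattice := [seq cell_of j | j <- enum_fset (supp v)].

Lemma cfg_out_cells v (l : seq lattice) j :
  {subset supp_cells v <= l} -> cell_of j \notin l ->
  cfg v j = 0.
Proof.
move=> sub jl; apply: cfg_out; apply: contra jl => jv.
by apply: sub; apply/mapP; exists j.
Qed.

Lemma tracks_pauliX v w : cfg w = f (cfg v) -> tracks (pauliX v) (pauliX w).
Proof.
move=> wv; exists (supp v); split.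
  by exists (fun=> 1), (cfg v); split=> //; [exact: cfg_out | exact: pauliX_phase_shift].
exists (supp_cells v) => l ul sub; rewrite !pauliX_phase_shift wv.
apply: functional_extensionality => psi; apply: functional_extensionality => s.
rewrite /conj_cells /phase_shift !mul1r; congr psi.
apply: functional_extensionality => j.
have := congr1 (@^~ j) (on_cellsK f_local fK l s); rewrite /= {1 3}/on_cells.
case: (boolP (cell_of j \in l)) => jl; first by rewrite fD => ->.
(* No gate acts here, but [v] vanishes on the whole cell of [j], and hence so does its image under
   [f]. *)
move=> ->; congr (_ + _); rewrite (cfg_out_cells sub jl).
by rewrite local_additive0 // => j' jj; apply: (cfg_out_cells sub); rewrite jj.
Qed.

Lemma tracks_pauliZ v w : (forall s, parity w s = parity v (f s)) ->
  tracks (pauliZ v) (pauliZ w).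
Proof.
move=> wv; exists (supp v); split.
  exists (fun s => (-1) ^+ parity v s), (fun=> 0); split=> //.
    by move=> s s' /parity_local ->.
  exact: pauliZ_phase_shift.
exists (supp_cells v) => l ul sub; rewrite !pauliZ_phase_shift.
apply: functional_extensionality => psi; apply: functional_extensionality => s.
rewrite /conj_cells /phase_shift wv; congr (_ ^+ _ * psi _).
  (* The phase reads only sites of [supp v], where the truncated product agrees with [f]. *)
  congr (nat_of_ord _); apply: parity_local => j jv; rewrite /on_cells.
  have -> // : cell_of j \in l by apply: sub; apply/mapP; exists j.
apply: functional_extensionality => j; rewrite addr0.
have -> : (fun j => on_cells f l s j + 0) = on_cells f l s.
  by apply: functional_extensionality => j'; rewrite addr0.
by rewrite (on_cellsK f_local fK).
Qed.

Variables WX WZ : 'cV[Laurent]_q -> 'cV[Laurent]_q.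
Hypothesis cfgW : forall v, cfg (WX v) = f (cfg v).
Hypothesis parityW : forall v s, parity (WZ v) s = parity v (f s).

Lemma same_order_of_cells a b a' b' (C : css q a b) (C' : css q a' b') :
  (forall w, exists w', WX (phiX C *m w) = phiX C' *m w') ->
  (forall w', exists w, WX (phiX C *m w) = phiX C' *m w') ->
  (forall w, exists w', WZ (phiZ C *m w) = phiZ C' *m w') ->
  (forall w', exists w, WZ (phiZ C *m w) = phiZ C' *m w') ->
  same_order K C C'.
Proof.
move=> hX hX' hZ hZ'; exists [:: cell_layer K f_local fK]; split=> O OC.
  suff [O' O'C' /tracks_circuit] : exists2 O', stabilizer C' O' & tracks O O'.
    by exists O'.
  elim: OC => [|w|w|P Q _ [P' P'C PP'] _ [Q' Q'C QQ']].
  - by exists id; [exact: stab1 | exact: tracks_id].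
  - have [w' e] := hX w; exists (pauliX (phiX C' *m w')); first exact: stabX.
    by apply: tracks_pauliX; rewrite -e cfgW.
  - have [w' e] := hZ w; exists (pauliZ (phiZ C' *m w')); first exact: stabZ.
    by apply: tracks_pauliZ => s; rewrite -e parityW.
  - by exists (P' \o Q'); [exact: stabM | exact: tracks_comp].
suff [P PC /tracks_circuit] : exists2 P, stabilizer C P & tracks P O by exists P.
elim: OC => [|w|w|P Q _ [P' P'C PP'] _ [Q' Q'C QQ']].
- by exists id; [exact: stab1 | exact: tracks_id].
- have [w' e] := hX' w; exists (pauliX (phiX C *m w')); first exact: stabX.
  by apply: tracks_pauliX; rewrite -e cfgW.
- have [w' e] := hZ' w; exists (pauliZ (phiZ C *m w')); first exact: stabZ.
  by apply: tracks_pauliZ => s; rewrite -e parityW.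
- by exists (P' \o Q'); [exact: stabM | exact: tracks_comp].
Qed.

End PauliTracking.

(** * The CNOT circuit of the homotopy *)

Section CellMap.
Variable c : 'cV['F_2]_3.
Implicit Types (s : config (3 + 3)) (j : qubit (3 + 3)).

(** The action of [hop true d] on coefficient functions; on test functions the same operator is dual
    to [hop false d]. *)
Definition hop_cfg (d : 'I_3) (t : lattice -> 'F_2) (m : lattice) : 'F_2 :=
  if even_at d m then 0 else t (m - step d).

(** Controls are among the first three qubits and targets among the last three. A target with odd
    coordinate is controlled from the preceding even one, inside the same cell. *)
Definition cell_cnot s : config (3 + 3) := fun j => s j +
  match split j.2 with
  | inl _ => 0
  | inr k => \sum_(i < 3) wt c k i * hop_cfg (dir k i) (fun m => s (m, lshift 3 i)) j.1
  end.

Lemma split_lshift m n (i : 'I_m) : split (lshift n i) = inl i.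
Proof. exact: (@unsplitK m n (inl i)). Qed.

Lemma split_rshift m n (k : 'I_n) : split (rshift m k) = inr k.
Proof. exact: (@unsplitK m n (inr k)). Qed.

Lemma halve_step d (m : lattice) : ~~ even_at d m -> halve (m - step d) = halve m.
Proof.
rewrite /even_at => md; apply/rowP => k; rewrite !mxE.
have [->|_] := eqVneq k d; rewrite /= ?subr0 //.
by move: md; rewrite dvdzE /=; lia.
Qed.

Lemma cell_cnot_local s s' j :
  (forall j', cell_of j' = cell_of j -> s j' = s' j') ->
  cell_cnot s j = cell_cnot s' j.
Proof.
move=> ss'; rewrite /cell_cnot ss' //; congr (_ + _).
case: (split j.2) => // k; apply: eq_bigr => i _; congr (_ * _).
rewrite /hop_cfg; case: ifP => // /negbT jd; apply: ss'.
exact: halve_step.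
Qed.

Lemma cell_cnotK : involutive cell_cnot.
Proof.
move=> s; apply: functional_extensionality => j.
rewrite /cell_cnot; case: (split j.2) => [i|k]; first by rewrite !addr0.
rewrite -addrA -[RHS]addr0; congr (_ + _); rewrite -[RHS](F2_addrr (\sum_(i < 3)
  wt c k i * hop_cfg (dir k i) (fun m => s (m, lshift 3 i)) j.1)).
congr (_ + _); apply: eq_bigr => i _; congr (_ * _).
by rewrite /hop_cfg; case: ifP => // _; rewrite split_lshift addr0.
Qed.

Lemma cell_cnotD s s' j :
  cell_cnot (fun j' => s j' + s' j') j = cell_cnot s j + cell_cnot s' j.
Proof.
rewrite /cell_cnot addrACA; congr (_ + _).
case: (split j.2) => [i|k]; first by rewrite addr0.
rewrite -big_split; apply: eq_bigr => i _ /=; rewrite -mulrDr; congr (_ * _).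
by rewrite /hop_cfg; case: ifP; rewrite ?addr0.
Qed.

Variable M : laurent_model.

Let F2_add2 : forall x : 'F_2, x + x = 0 := F2_addrr.

Lemma lext_cst (t : lattice -> 'F_2) x (r : M) :
  lext t (cst M x * r) = x * lext t r.
Proof.
have tD := lextD (l := M) t F2_add2.
by case: (F2_cases x) => ->; rewrite /cst ?mulr1n ?mul1r // mulr0n !mul0r morph_add0.
Qed.

Lemma lext_hop (t : lattice -> 'F_2) d (r : M) :
  lext t (hop false d r) = lext (hop_cfg d t) r.
Proof.
have tD := lextD (l := M) _ F2_add2.
move: r; apply: eq_mono => [r r'|r r'|m]; rewrite ?hopD ?tD //.
rewrite hop_mono [RHS]lext_mono // /hop_cfg; case: even_at => /=.
  by rewrite (morph_add0 (tD t)).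
by rewrite lext_mono.
Qed.

Definition lcoef (m : lattice) : M -> 'F_2 := lext (fun n => (n == m)%:R).

Lemma lcoef_hop m d (r : M) :
  lcoef m (hop true d r) = hop_cfg d (lcoef^~ r) m.
Proof.
have tD := lextD (l := M) _ F2_add2.
move: r; apply: eq_mono => [r r'|r r'|n]; rewrite ?hopD.
- by rewrite /lcoef tD.
- by rewrite /hop_cfg; case: ifP; rewrite ?addr0 // /lcoef tD.
have n_step : even_at d (n + step d) = ~~ even_at d n.
  by rewrite addrC (even_at_step false) eqxx.
have -> : hop_cfg d (lcoef^~ (mono M n)) m =
    if even_at d m then 0 else (n + step d == m)%:R.
  by rewrite /hop_cfg /lcoef lext_mono // eq_sym subr_eq eq_sym.
rewrite hop_mono /unit_step opprK eqb_id.
have [<-|/negPf nm] := eqVneq (n + step d) m.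
  rewrite n_step /lcoef; case: even_at; rewrite /= ?lext_mono ?eqxx //.
  by rewrite (morph_add0 (tD _)).
rewrite if_same /lcoef; case: even_at; rewrite ?lext_mono ?nm //.
by rewrite (morph_add0 (tD _)).
Qed.

Lemma lcoef_shear v j : lcoef j.1 (shear_down (hcol (M := M) true c) v j.2 0) =
  cell_cnot (fun j' => lcoef j'.1 (v j'.2 0)) j.
Proof.
have coefD m := lextD (l := M) (fun n => (n == m)%:R) F2_add2.
case: j => m i; rewrite /cell_cnot /= -{2}[v]vsubmxK mxE; case: splitP => k ik.
  have -> : i = lshift 3 k by apply: val_inj.
  rewrite col_mxEu addr0 //.
have -> : i = rshift 3 k by apply: val_inj.
rewrite col_mxEd mxE /lcoef coefD; congr (_ + _).
rewrite mxE (morph_sum (coefD m)); apply: eq_bigr => i' _.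
by rewrite lext_cst -[lext _ (hop _ _ _)]/(lcoef m _) lcoef_hop mxE.
Qed.

Definition parityM (v : 'cV[M]_(3 + 3)) s : 'F_2 :=
  \sum_(i < 3 + 3) lext (fun m => s (m, i)) (v i 0).

(** [hop_cfg] moves each hop from the vector to the configuration, and [wt] and [dir] are symmetric;
    the upper shear is thus the transpose of [cell_cnot]. *)
Lemma parityM_shear v s :
  parityM (shear_up (hcol (M := M) false c) v) s = parityM v (cell_cnot s).
Proof.
have tD (t : lattice -> 'F_2) := lextD (l := M) t F2_add2.
have tDl (t t' : lattice -> 'F_2) (r : M) :
    lext (fun m => t m + t' m) r = lext t r + lext t' r.
  move: r; apply: eq_mono => [r r'|r r'|m]; first by rewrite tD.
    by rewrite !tD addrACA.
  by rewrite !lext_mono.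
have tsum (F : 'I_3 -> lattice -> 'F_2) (r : M) :
    lext (fun m => \sum_(i < 3) F i m) r = \sum_(i < 3) lext (F i) r.
  move: r; apply: eq_mono => [r r'|r r'|m]; first by rewrite tD.
    by rewrite -big_split; apply: eq_bigr => i _; rewrite tD.
  rewrite lext_mono //; by apply: eq_bigr => i _; rewrite lext_mono.
have tscale x (t : lattice -> 'F_2) (r : M) : lext (fun m => x * t m) r = x * lext t r.
  move: r; apply: eq_mono => [r r'|r r'|m]; first by rewrite tD.
    by rewrite tD mulrDr.
  by rewrite !lext_mono.
rewrite /parityM !big_split_ord /=.
have e1 (i : 'I_3) : lext (fun m => s (m, lshift 3 i))
      (shear_up (hcol false c) v (lshift 3 i) 0) =
    lext (fun m => s (m, lshift 3 i)) (v (lshift 3 i) 0) +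
    \sum_(k < 3) wt c k i *
      lext (hop_cfg (dir k i) (fun m => s (m, lshift 3 i))) (v (rshift 3 k) 0).
  rewrite col_mxEu mxE tD mxE; congr (_ + _).
  rewrite mxE (morph_sum (tD _)); apply: eq_bigr => k _.
  by rewrite lext_cst lext_hop wtC dirC mxE.
have e2 (i : 'I_3) : lext (fun m => cell_cnot s (m, lshift 3 i)) (v (lshift 3 i) 0) =
    lext (fun m => s (m, lshift 3 i)) (v (lshift 3 i) 0).
  congr (lext _ _); apply: functional_extensionality => m.
  by rewrite /cell_cnot split_lshift addr0.
have e3 (k : 'I_3) : lext (fun m => cell_cnot s (m, rshift 3 k)) (v (rshift 3 k) 0) =
    lext (fun m => s (m, rshift 3 k)) (v (rshift 3 k) 0) +
    \sum_(i < 3) wt c k i *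
      lext (hop_cfg (dir k i) (fun m => s (m, lshift 3 i))) (v (rshift 3 k) 0).
  rewrite -[RHS]/(_ + _); under [in RHS]eq_bigr => i _ do rewrite -tscale.
  rewrite -tsum -tDl; congr (lext _ _); apply: functional_extensionality => m.
  by rewrite /cell_cnot split_rshift.
rewrite (eq_bigr _ (fun i _ => e1 i)) (eq_bigr _ (fun i _ => e2 i)).
(* Both sides contain the same double sum over controls and targets, summed in opposite orders. *)
rewrite (eq_bigr _ (fun i _ => e3 i)) !big_split /= exchange_big -addrA; congr (_ + _).
rewrite addrC; congr (_ + _); apply: eq_bigr => k _.
by rewrite col_mxEd mxE.
Qed.

End CellMap.

(** * Specialization to Laurent polynomials *)

Section Dagger.
Variable M : laurent_model.

Lemma mbar_fac b i : mbar (fac M b i) = fac M (~~ b) i.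
Proof.
rewrite /fac !lm_oppr mbarD mbar1 mbar_mono; congr (mono M _ + 1).
by case: b; rewrite /= ?opprK.
Qed.

Lemma mbar_cst x : mbar (cst M x) = cst M x.
Proof. by case: (cst_cases M x) => ->; rewrite ?mbar0 ?mbar1. Qed.

Lemma mbar_fac_col b : map_mx (@mbar M) (fac_col M b) = fac_col M (~~ b).
Proof. by apply/matrixP; apply: ord3P => j; rewrite !ord1 !mxE /= mbar_fac. Qed.

Lemma mbar_fac_mx b : map_mx (@mbar M) (fac_mx M b) = fac_mx M (~~ b).
Proof.
by apply/matrixP; apply: ord3P; apply: ord3P; rewrite !mxE /= ?mbar_fac ?mbar0.
Qed.

Lemma mbar_cst_col c : map_mx (@mbar M) (cst_col M c) = cst_col M c.
Proof. by apply/matrixP => i j; rewrite !mxE mbar_cst. Qed.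

Lemma codeX_dagE c : (map_mx (@mbar M) (codeX M c))^T = codeX_dag M c.
Proof.
rewrite /codeX map_block_mx tr_block_mx mbar_fac_col mbar_cst_col mbar_fac_mx.
rewrite fac_mx_tr /codeX_dag; congr block_mx.
by apply/matrixP => i j; rewrite !mxE mbar0.
Qed.

End Dagger.

Lemma bar_mbar : bar = @mbar laurentM.
Proof.
apply: functional_extensionality => r.
rewrite /mbar /push /mlift /= /Laurent_lift /gaext /bar; apply: eq_bigr => m _.
by case: (F2_cases (gacoef m r)) => ->; rewrite ?gamon0 ?mulr0n ?mulr1n.
Qed.

Lemma lconst_cst x : lconst x = cst laurentM x.
Proof.
by case: (F2_cases x) => ->; rewrite /lconst /cst ?gamon0 ?mulr0n ?mulr1n.
Qed.

Lemma d1E : dag d1 = fac_col laurentM true.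
Proof.
rewrite -[true]/(~~ false) -mbar_fac_col /dag bar_mbar; apply/matrixP; apply: ord3P => j;
  by rewrite !ord1 !mxE.
Qed.

Lemma d3E : d3 = fac_col laurentM false.
Proof. by apply/matrixP; apply: ord3P => j; rewrite !ord1 !mxE. Qed.

Lemma d2E : d2 = fac_mx laurentM false.
Proof.
by apply/matrixP; apply: ord3P; apply: ord3P; rewrite !mxE /= ?(lm_oppr (M := laurentM)).
Qed.

Lemma cst_colE a : map_mx lconst a = cst_col laurentM a.
Proof. by apply/matrixP => i j; rewrite 2!mxE lconst_cst. Qed.

Lemma phiX_Ca a : phiX (Ca a) = codeX laurentM a.
Proof.
rewrite /= d1E /codeX; congr block_mx.
  rewrite cst_colE bar_mbar (mbar_cst_col laurentM).
  by apply/matrixP => i j; rewrite [LHS]mxE; exact: (@lm_oppr laurentM).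
by rewrite /dag bar_mbar d2E (mbar_fac_mx laurentM) (fac_mx_tr laurentM).
Qed.

Lemma phiZ_Ca a : phiZ (Ca a) = codeZ laurentM a.
Proof. by rewrite /= d2E d3E cst_colE. Qed.

Definition code (a : 'cV['F_2]_3) : css (3 + 3) (1 + 3) (3 + 1) :=
  CSS (codeX laurentM a) (codeZ laurentM a).

Lemma Ca_code a : Ca a = code a.
Proof. by case: (Ca a) (phiX_Ca a) (phiZ_Ca a) => X Z /= -> ->. Qed.

Lemma topological_code a : topological (code a).
Proof.
move=> v; rewrite /dag bar_mbar (codeX_dagE laurentM).
exact: (@codeX_dag_exact laurentM).
Qed.

Lemma RLambda_ind (P : Laurent -> Prop) :
  P 0 -> (forall m, in_Lambda m -> P (xmon m)) ->
  (forall r s, P r -> P s -> P (r + s)) -> forall x : RLambda, P (val x).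
Proof.
move=> P0 Pmon PD [r /= /over_LambdaP rL]; rewrite (gaE r).
apply: big_ind => [||m _]; [exact: P0 | exact: PD |].
case: (F2_cases (gacoef m r)) => e; rewrite e; first by rewrite gamon0.
by apply: Pmon; apply: rL; rewrite e.
Qed.

Lemma coordL_mlift e r : val (coordL e r) =
  mlift (M := laurentM)
    (fun m => if in_Lambda (m - corner e) then xmon (m - corner e) else 0) r.
Proof.
rewrite /= /coordL_val /mlift /= /Laurent_lift /gaext big_mkcond /=.
apply: eq_bigr => m _; case: (in_Lambda (m - corner e)); last by rewrite mul0rn.
by case: (F2_cases (gacoef m r)) => ->; rewrite ?gamon0 ?mulr0n ?mulr1n.
Qed.

Lemma block_blkop q a (phi : 'M[Laurent]_(q, a)) :
  block phi = @blkop laurentM RLambda coordL _ _ (mulmx phi).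
Proof. by symmetry; apply: (@blkop_mulmx laurentM). Qed.

(* Rewriting at one of two distinct blocked matrices compares them up to
   conversion, which does not terminate in practice. *)
Lemma transport2 T U (P : T -> U -> Prop) x x' y y' :
  x = x' -> y = y' -> P x' y' -> P x y.
Proof. by move=> -> ->. Qed.

Lemma cl_equiv_code a : cl_equiv (block (phiX (code a))) (block (phiX (code 0))).
Proof.
apply: (transport2 (P := @cl_equiv RLambda _ _) (block_blkop _) (block_blkop _)).
exact: (@cl_equiv_codeX laurentM RLambda (val : {rmorphism RLambda -> Laurent})
  val_inj RLambda_ind coordL coordL_mlift a).
Qed.

Lemma gacoef_lcoef m (r : Laurent) : gacoef m r = lcoef (M := laurentM) m r.
Proof.
have F2_2 := F2_addrr.
apply: (@eq_mono laurentM _ (gacoef m) (lcoef (M := laurentM) m)) => [r' s|r' s|n].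
- exact: gacoefD.
- exact: (lextD (l := laurentM)).
- by rewrite /lcoef lext_mono //= /xmon gacoef_mon.
Qed.

(** Every coefficient on the support is 1, so the weighted sum is the plain one. *)
Lemma parity_parityM v s : @parity (3 + 3) v s = parityM (M := laurentM) v s.
Proof.
apply: eq_bigr => i _; rewrite /= /Laurent_lift /gaext big_seq [RHS]big_seq.
apply: eq_bigr => m; rewrite -mcoeff_neq0 -[(v i 0)@_m]/(gacoef m (v i 0)).
by case: (F2_cases (gacoef m (v i 0))) => -> //; rewrite mulr1n.
Qed.

Lemma Ca0E : Ca 0 = css_sum TC1 TC2.
Proof.
have z : map_mx lconst 0 = 0 :> 'cV_3.
  by apply/matrixP => i j; rewrite !mxE lconst_cst.
rewrite /Ca /css_sum z; congr CSS => /=; congr block_mx.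
by apply/matrixP => i j; rewrite !mxE (lm_oppr (M := laurentM)) bar_mbar mbar0.
Qed.

Lemma cfg_lcoef (v : 'cV[Laurent]_(3 + 3)) :
  cfg v = fun j => lcoef (M := laurentM) j.1 (v j.2 0).
Proof. by apply: functional_extensionality => j; exact: gacoef_lcoef. Qed.

Lemma cfg_shear a (v : 'cV[Laurent]_(3 + 3)) :
  cfg (@shear_down laurentM 3 3 (hcol true a) v) = cell_cnot a (cfg v).
Proof.
refine (etrans (cfg_lcoef _) (etrans _ (congr1 (cell_cnot a) (esym (cfg_lcoef v))))).
by apply: functional_extensionality => j; exact: (@lcoef_shear a laurentM v j).
Qed.

(** Each shear identity maps generators of one code into the other, and its inverted form shows that
    all generators are reached. *)
Lemma same_order_code K a : same_order K (code a) (code 0).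
Proof.
apply: (@same_order_of_cells K (3 + 3) _ (@cell_cnot_local a) (@cell_cnotK a)
  (@cell_cnotD a) (@shear_down laurentM 3 3 (hcol true a))
  (@shear_up laurentM 3 3 (hcol false a))).
- exact: cfg_shear.
- by move=> v s; rewrite !parity_parityM parityM_shear.
- by move=> w; eexists; exact: (@shear_codeX laurentM).
- by move=> w; eexists; exact: (@shear_codeX_inv laurentM).
- by move=> w; eexists; exact: (@shear_codeZ laurentM).
- by move=> w; eexists; exact: (@shear_codeZ_inv laurentM).
Qed.

Theorem fact12 (a : 'cV['F_2]_3) :
  [/\ blocked_cl_equiv (Ca a) (Ca 0%R),
      Ca 0%R = css_sum TC1 TC2
    & forall K : numClosedFieldType, same_order K (Ca a) (css_sum TC1 TC2)].
Proof.
split; last move=> K.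
- apply: (transport2 (P := fun C C' => blocked_cl_equiv C C') (Ca_code a) (Ca_code 0)).
  split; [exact: topological_code | exact: topological_code | exact: cl_equiv_code].
- exact: Ca0E.
apply: (transport2 (P := fun C C' => same_order K C C') (Ca_code a)
  (etrans (esym Ca0E) (Ca_code 0))).
exact: same_order_code.
Qed.
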